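(* For $\lambda,\mu>0$ let $K_{\lambda,\mu}$ be the positive definite kernel on the open unit disc $\mathbb D$ given by $$K_{\lambda,\mu}(z,w)=\sum_{k=0}^\infty\frac{(\lambda)_k}{(\mu)_k}(z\bar w)^k\qquad(z,w\in\mathbb D).$$ Let $0<\mu\leq\lambda'\leq\lambda\leq\lambda'+1$. Then the multiplication operator $M_z$ on $\mathcal H(K_{\lambda,\mu}+K_{\lambda',\mu})$ is a contractive subnormal operator.
   Context: $\mathbb D=\{z\in\mathbb C:|z|<1\}$, and $(x)_n=\Gamma(x+n)/\Gamma(x)$ is the Pochhammer symbol. For a positive definite kernel $K$ on $\mathbb D$ (holomorphic in the first variable and anti-holomorphic in the second), $\mathcal H(K)$ denotes the reproducing kernel Hilbert space of holomorphic functions on $\mathbb D$ with reproducing kernel $K$, and $M_z$ denotes the operator of multiplication by the coordinate function, $(M_zf)(z)=zf(z)$. A bounded operator $T$ on a Hilbert space $\mathcal H$ is subnormal if there are a Hilbert space $\mathcal K\supset\mathcal H$ and a bounded normal operator $N$ on $\mathcal K$ with $N(\mathcal H)\subset\mathcal H$ and $N|_{\mathcal H}=T$. Contractive means $\|T\|\leq 1$. *)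

(* Defs.v *)
From HB Require Import structures.
From mathcomp Require Import all_boot all_order all_algebra sesquilinear.
From mathcomp Require Import complex.
From mathcomp Require Import all_classical all_reals all_analysis.

Set Implicit Arguments.
Unset Strict Implicit.
Unset Printing Implicit Defensive.
Import Order.TTheory GRing.Theory Num.Theory.
Import numFieldNormedType.Exports.

Local Open Scope classical_set_scope.
Local Open Scope ring_scope.
Local Open Scope complex_scope.

(* Inner products are linear in the first argument and conjugate linear in the
   second one ([{dot _ for _}] of sesquilinear). Norms of a normed module over
   [R[i]] take values in [R[i]], where [a <= b] implies that [b - a] is real. *)
Record hilbertSpace (R : realType) := HilbertSpace {
  hilbert_sort :> completeNormedModType R[i] ;
  inner : {dot hilbert_sort for (@Num.conj R[i])} ;
  inner_norm : forall x : hilbert_sort, inner x x = `|x| ^+ 2 }.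

Definition bounded_operator (R : realType) (H K : hilbertSpace R)
    (T : {linear H -> K}) : Prop :=
  exists M : R, forall x : H, `|T x| <= M%:C * `|x|.

(* [sup] of an unbounded set is [0], so this is meaningful for bounded [T]. *)
Definition operator_norm (R : realType) (H K : hilbertSpace R)
    (T : {linear H -> K}) : R :=
  sup [set complex.Re `|T x| | x in [set x : H | `|x| <= 1]].

Definition contractive (R : realType) (H : hilbertSpace R)
    (T : {linear H -> H}) : Prop :=
  bounded_operator T /\ operator_norm T <= 1.

Definition is_adjoint (R : realType) (H : hilbertSpace R)
    (T S : {linear H -> H}) : Prop :=
  forall x y : H, inner H (T x) y = inner H x (S y).

Definition normal_operator (R : realType) (H : hilbertSpace R)
    (N : {linear H -> H}) : Prop :=
  exists S : {linear H -> H},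
    [/\ bounded_operator S, is_adjoint N S & forall x : H, N (S x) = S (N x)].

(* The inclusion of [H] into the larger Hilbert space is rendered by a linear
   isometric embedding [V]; invariance of [V H] under [N] is part of the
   intertwining relation. *)
Definition subnormal (R : realType) (H : hilbertSpace R)
    (T : {linear H -> H}) : Prop :=
  bounded_operator T /\
  exists (K : hilbertSpace R) (V : {linear H -> K}) (N : {linear K -> K}),
    [/\ forall x y : H, inner K (V x) (V y) = inner H x y,
        bounded_operator N,
        normal_operator N
      & forall x : H, N (V x) = V (T x)].

Definition unit_disc (R : realType) : set R[i] := [set z | `|z| < 1].

Definition holomorphic_on (R : realType) (D : set R[i]) (f : R[i] -> R[i]) :
    Prop :=
  forall z, D z -> derivable (f : R[i]^o -> R[i]^o) z 1.

(* A reproducing kernel Hilbert space of holomorphic functions on the unit disc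
   with kernel [k]. A vector [f] stands for the function [rkhs_eval f] on the
   disc (whose values off the disc are irrelevant); [rkhs_eval_inj] identifies
   vectors with functions. For a given kernel, such a space is unique up to a
   unitary operator that commutes with evaluation. *)
Record rkhs (R : realType) (k : R[i] -> R[i] -> R[i]) := Rkhs {
  rkhs_space :> hilbertSpace R ;
  rkhs_eval : rkhs_space -> R[i] -> R[i] ;
  rkhs_eval_linear : forall (a : R[i]) (f g : rkhs_space) (z : R[i]),
    unit_disc z ->
    rkhs_eval (a *: f + g) z = a * rkhs_eval f z + rkhs_eval g z ;
  rkhs_eval_inj : forall f g : rkhs_space,
    (forall z, unit_disc z -> rkhs_eval f z = rkhs_eval g z) -> f = g ;
  rkhs_holomorphic : forall f : rkhs_space,
    holomorphic_on (@unit_disc R) (rkhs_eval f) ;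
  rkhs_reproducing : forall w : R[i], unit_disc w ->
    exists kw : rkhs_space,
      (forall z, unit_disc z -> rkhs_eval kw z = k z w) /\
      (forall f : rkhs_space, inner rkhs_space f kw = rkhs_eval f w) }.

Definition is_mulz (R : realType) (k : R[i] -> R[i] -> R[i]) (H : rkhs k)
    (T : {linear H -> H}) : Prop :=
  forall (f : H) (z : R[i]), unit_disc z ->
    rkhs_eval (T f) z = z * rkhs_eval f z.

Definition Gamma (R : realType) (x : R) : R :=
  \int[lebesgue_measure]_(t in `]0, +oo[) (t `^ (x - 1) * expR (- t)).

Definition pochhammer (R : realType) (x : R) (n : nat) : R :=
  Gamma (x + n%:R) / Gamma x.

Definition kernel_lm (R : realType) (lambda mu : R) (z w : R[i]) : R[i] :=
  limn (series (fun n : nat =>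
    ((pochhammer lambda n / pochhammer mu n)%:C * (z * w^*) ^+ n : R[i]^o))).

(* Main.v *)
Require Import Defs.
From HB Require Import structures.
From mathcomp Require Import all_boot all_order all_algebra sesquilinear.
From mathcomp Require Import complex polyXY ring lra.
From mathcomp Require Import all_classical all_reals all_analysis measurable_realfun.

Set Implicit Arguments.
Unset Strict Implicit.
Unset Printing Implicit Defensive.
Import Order.TTheory GRing.Theory Num.Theory.
Import numFieldNormedType.Exports.

Local Open Scope classical_set_scope.
Local Open Scope ring_scope.

(** Write [a k = (lambda)_k / (mu)_k + (lambda')_k / (mu)_k], so that the kernel is
    the sum of the [a k (z * conj w)^k]. In its space the monomials are orthogonal with
    [|z^k|^2 = 1 / a k] and multiplication by [z] is a weighted shift. Such a shift
    is a subnormal contraction when the [1 / a k] are the moments of a measure on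
    [[0, 1]], that is, when they form a completely monotone sequence; the normal
    extension is then multiplication by [z] in L^2 of a rotation-invariant measure
    on the closed disc.

    Complete monotonicity ([completely_monotone_inv_rising_sum]). One has
    [1 / a k = (mu)_k / (lambda')_k * 1 / (1 + phi k)] with
    [phi k = (lambda)_k / (lambda')_k]. Ratios [(b)_k / (c)_k] with [b <= c] are
    completely monotone ([completely_monotone_rising_ratio]), and so are inverses of
    positive sequences with completely monotone increments
    ([completely_monotone_inv]). The increments of [phi] are multiples of
    [(lambda)_k / (lambda' + 1)_k], to which the first fact applies because
    [lambda <= lambda' + 1]. A product of completely monotone sequences is
    completely monotone.

    The normal extension ([completely_monotone_normal_model]). No representing
    measure is constructed. For a completely monotone sequence [g], the functional
    sending [x^k] to [g k] is nonnegative on polynomials that are nonnegative on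
    [[0, 1]] ([completely_monotone_functional_ge0], by Bernstein's approximate
    measures). Hence the form in which [z^a zbar^b] and [z^c zbar^d] have inner
    product [g (a + d)] if [a + d = b + c], and [0] otherwise, is positive
    semidefinite on polynomials in [z] and [zbar], and multiplication by [z] is a
    contraction for it, with adjoint the multiplication by [zbar]
    ([diagpart_square_ge0], [moment_form_coord]). Both extend to the completion.

    The embedding ([multiplication_restricts]). The kernel function at [w] is sent
    to the sum of the [a k (conj w)^k z^k] in the completion; this preserves inner
    products and extends to an isometry of the whole space
    ([isometric_extension]). By uniqueness of power series its range contains the
    monomials ([power_in_range]), so that it is invariant under multiplication by
    [z], and this multiplication pulls back to the multiplication operator.

    Pochhammer symbols being defined through the Gamma integral, the functional
    equation of [Gamma] and its positivity identify them with rising factorials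
    ([pochhammerE]). *)

(** * Completely monotone sequences *)

Section CompletelyMonotone.
Variable R : realType.
Implicit Types f g : nat -> R.

Definition decrement f (k : nat) : R := f k - f k.+1.

(** Complete monotonicity up to a finite order: it is the induction on this
    order that proves the closure properties below. *)
Fixpoint monotone_upto (n : nat) f : Prop :=
  (forall k, 0 <= f k) /\
  (if n is n'.+1 then monotone_upto n' (decrement f) else True).

Definition completely_monotone f := forall n, monotone_upto n f.

Lemma monotone_upto_ge0 n f k : monotone_upto n f -> 0 <= f k.
Proof. by case: n => [|n] [+ _]; exact. Qed.

Lemma eq_monotone_upto n f g : f =1 g -> monotone_upto n f -> monotone_upto n g.
Proof. by move=> /funext ->. Qed.

Lemma monotone_upto_pred n f : monotone_upto n.+1 f -> monotone_upto n f.
Proof.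
elim: n f => [|n IHn] f [f0 df]; first by split.
by split=> //; exact: IHn.
Qed.

Lemma monotone_upto_shift n f :
  monotone_upto n f -> monotone_upto n (fun k => f k.+1).
Proof.
elim: n f => [|n IHn] f [f0 df]; first by split.
by split=> //; exact: (IHn _ df).
Qed.

Lemma monotone_uptoD n f g : monotone_upto n f -> monotone_upto n g ->
  monotone_upto n (fun k => f k + g k).
Proof.
elim: n f g => [|n IHn] f g [f0 df] [g0 dg].
  by split=> // k; rewrite addr_ge0.
split=> [k|]; first by rewrite addr_ge0.
by apply: (eq_monotone_upto _ (IHn _ _ df dg)) => k; rewrite /decrement; ring.
Qed.

(** The decrement of a product obeys a Leibniz rule in which one factor is
    shifted, and shifts preserve monotonicity of any order. *)
Lemma monotone_uptoM n f g : monotone_upto n f -> monotone_upto n g ->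
  monotone_upto n (fun k => f k * g k).
Proof.
elim: n f g => [|n IHn] f g.
  by move=> [f0 _] [g0 _]; split=> // k; rewrite mulr_ge0.
move=> hf hg; split=> [k|].
  by rewrite mulr_ge0 ?(monotone_upto_ge0 k hf) ?(monotone_upto_ge0 k hg).
have [[_ df] [_ dg]] := (hf, hg).
apply: (eq_monotone_upto _
  (monotone_uptoD (IHn _ _ df (monotone_upto_pred hg))
    (IHn _ _ (monotone_upto_shift (monotone_upto_pred hf)) dg))) => k.
by rewrite /decrement; ring.
Qed.

Lemma monotone_upto_cst n (c : R) : 0 <= c -> monotone_upto n (fun=> c).
Proof.
elim: n c => [|n IHn] c c0; split=> //.
by apply: (eq_monotone_upto _ (IHn 0 _)) => // k; rewrite /decrement subrr.
Qed.

(** A sequence whose decrement inherits its own order of monotonicity gains one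
    order at each step, hence has all of them. *)
Lemma completely_monotone_rec f D : (forall k, 0 <= f k) ->
    (forall k, decrement f k = D k) ->
    (forall n, monotone_upto n f -> monotone_upto n D) ->
  completely_monotone f.
Proof.
move=> f0 fD fDn; elim=> [|n IHn]; first by split.
by split=> //; apply: (eq_monotone_upto _ (fDn _ IHn)) => k; rewrite fD.
Qed.

(** Discrete version of the fact that the inverse of a Bernstein function is
    completely monotone: the decrement of [1 / f] at [k] is
    [D k / (f k * f k.+1)], a product of [D] with two copies of [1 / f]. *)
Lemma completely_monotone_inv f D : (forall k, 0 < f k) ->
    (forall k, f k.+1 - f k = D k) -> completely_monotone D ->
  completely_monotone (fun k => (f k)^-1).
Proof.
move=> f0 fD cmD.
apply: (@completely_monotone_rec _ (fun k => D k * ((f k)^-1 * (f k.+1)^-1))).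
- by move=> k; rewrite invr_ge0 ltW.
- by move=> k; rewrite /decrement -fD; field; rewrite !gt_eqF.
- move=> n cmf; apply: monotone_uptoM => //; apply: monotone_uptoM => //.
  exact: monotone_upto_shift cmf.
Qed.

Lemma completely_monotone_shift_inv (c : R) : 0 < c ->
  completely_monotone (fun k => (c + k%:R)^-1).
Proof.
move=> c0; apply: (@completely_monotone_inv _ (fun=> 1)).
- by move=> k; rewrite ltr_pwDl.
- by move=> k; rewrite -natr1; ring.
- by move=> n; exact: monotone_upto_cst.
Qed.

Definition rising (x : R) (n : nat) : R := \prod_(i < n) (x + i%:R).

Lemma rising_gt0 x n : 0 < x -> 0 < rising x n.
Proof. by move=> x0; apply: prodr_gt0 => i _; rewrite ltr_pwDl. Qed.

Lemma risingS x n : rising x n.+1 = rising x n * (x + n%:R).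
Proof. by rewrite /rising big_ord_recr. Qed.

Lemma rising_shift x n : x * rising (x + 1) n = rising x n * (x + n%:R).
Proof.
rewrite -risingS /rising big_ord_recl addr0; congr (_ * _).
by apply: eq_bigr => i _; rewrite /bump /= natrD addrA.
Qed.

(** For [a < b] these are the moments of a beta distribution; the proof only uses
    that the decrement is the ratio itself times [(b - a) / (b + k)]. *)
Lemma completely_monotone_rising_ratio (a b : R) : 0 < a -> a <= b ->
  completely_monotone (fun k => rising a k / rising b k).
Proof.
move=> a0 ab; have b0 := lt_le_trans a0 ab.
pose h k : R := (b - a) * (b + k%:R)^-1.
apply: (@completely_monotone_rec _ (fun k => rising a k / rising b k * h k)).
- by move=> k; rewrite divr_ge0 ?ltW ?rising_gt0.
- move=> k; rewrite /decrement !risingS /h.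
  by field; rewrite !gt_eqF ?rising_gt0 ?ltr_pwDl.
- move=> n cmf; apply: monotone_uptoM => //; apply: monotone_uptoM.
    by apply: monotone_upto_cst; rewrite subr_ge0.
  exact: completely_monotone_shift_inv.
Qed.

(** The sequence is the product of [(m)_k / (l')_k] and [1 / (1 + phi k)] with
    [phi k = (l)_k / (l')_k]. The increments of [phi] are proportional to
    [(l)_k / (l' + 1)_k], and this is where [l <= l' + 1] enters. *)
Lemma completely_monotone_inv_rising_sum (l l' m : R) :
    0 < m -> m <= l' -> l' <= l -> l <= l' + 1 ->
  completely_monotone
    (fun k => (rising l k / rising m k + rising l' k / rising m k)^-1).
Proof.
move=> m0 ml' l'l ll'; have l'0 := lt_le_trans m0 ml'.
have l0 := lt_le_trans l'0 l'l.
pose phi k := rising l k / rising l' k.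
have cmphi : completely_monotone (fun k => (1 + phi k)^-1).
  apply: (@completely_monotone_inv _
    (fun k => (l - l') / l' * (rising l k / rising (l' + 1) k))).
  - by move=> k; rewrite addr_gt0 // divr_gt0 ?rising_gt0.
  - move=> k; rewrite /phi !risingS.
    have -> : rising (l' + 1) k = rising l' k * (l' + k%:R) / l'.
      by rewrite -rising_shift mulrC mulKf ?gt_eqF.
    by field; rewrite !gt_eqF ?rising_gt0 ?ltr_pwDl.
  - move=> n; apply: monotone_uptoM.
      by apply: monotone_upto_cst; rewrite divr_ge0 ?subr_ge0 ?(ltW l'0).
    exact: completely_monotone_rising_ratio.
move=> n; apply: (eq_monotone_upto _
  (monotone_uptoM (completely_monotone_rising_ratio m0 ml' n)
     (cmphi n))) => k.
rewrite /phi; field.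
have r0 x : 0 < x -> rising x k != 0 by move=> x0; rewrite gt_eqF ?rising_gt0.
by rewrite !r0 //= andbT gt_eqF ?addr_gt0 ?rising_gt0.
Qed.

End CompletelyMonotone.

(** * The functional equation of the Gamma function *)

Section GammaFunction.
Variable R : realType.
Local Notation mu := (@lebesgue_measure R).
Implicit Types x t a b : R.

Definition gamma_integrand x t : R := t `^ (x - 1) * expR (- t).

Lemma gamma_integrand_ge0 x t : 0 <= gamma_integrand x t.
Proof. by rewrite mulr_ge0 ?powR_ge0 ?expR_ge0. Qed.

Lemma is_derive_gamma_integrand x t : 0 < t ->
  is_derive t 1 (gamma_integrand (x + 1))
    (x * gamma_integrand x t - gamma_integrand (x + 1) t).
Proof.
move=> t0; rewrite /gamma_integrand addrK.
have := is_derive1_powR x t0 => d1.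
have d2 : is_derive t 1 (fun s => expR (- s)) (- expR (- t)).
  by apply: is_derive_eq; rewrite /GRing.scale /=; ring.
apply: is_derive_eq; rewrite /GRing.scale /=; ring.
Qed.

Lemma continuous_gamma_integrand x t :
  0 < t -> {for t, continuous (gamma_integrand x)}.
Proof.
move=> t0; have [dt _] := is_derive_gamma_integrand (x - 1) t0.
by apply: differentiable_continuous; apply/derivable1_diffP; rewrite -[x](subrK 1).
Qed.

Lemma within_continuous_pos (f : R -> R) a b : 0 < a ->
  (forall t, 0 < t -> {for t, continuous f}) -> {within `[a, b], continuous f}.
Proof.
move=> a0 cf; apply: continuous_in_subspaceT => t.
by rewrite inE /= in_itv /= => /andP[/(lt_le_trans a0) /cf].
Qed.

Lemma FTC_pos (F f : R -> R) a b : 0 < a -> a < b ->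
    (forall t, 0 < t -> is_derive t 1 F (f t)) ->
    (forall t, 0 < t -> {for t, continuous f}) ->
  \int[mu]_(t in `[a, b]) f t = F b - F a.
Proof.
move=> a0 ab dF cf.
have cF t : 0 < t -> {for t, continuous F}.
  move=> /dF[dt _].
  by apply: differentiable_continuous; apply/derivable1_diffP.
rewrite /Rintegral (@continuous_FTC2 _ f F) //.
- exact: within_continuous_pos.
- split.
  + by move=> t; rewrite in_itv /= => /andP[/(lt_trans a0) /dF[]].
  + by apply: cvg_at_right_filter; exact: cF.
  + by apply: cvg_at_left_filter; apply: cF; exact: lt_trans ab.
- move=> t; rewrite in_itv /= => /andP[/(lt_trans a0) /dF dt _].
  by rewrite derive1E derive_val.
Qed.

Lemma integrable_pos (f : R -> R) a b : 0 < a ->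
    (forall t, 0 < t -> {for t, continuous f}) ->
  mu.-integrable `[a, b] (EFin \o f).
Proof.
move=> a0 cf; apply: continuous_compact_integrable; first exact: segment_compact.
exact: within_continuous_pos.
Qed.

Lemma gamma_integrand_parts x a b : 0 < a -> a < b ->
  x * \int[mu]_(t in `[a, b]) gamma_integrand x t =
  \int[mu]_(t in `[a, b]) gamma_integrand (x + 1) t +
  (gamma_integrand (x + 1) b - gamma_integrand (x + 1) a).
Proof.
move=> a0 ab; have cg y := @continuous_gamma_integrand y.
have cD t : 0 < t ->
    {for t, continuous (fun t => x * gamma_integrand x t - gamma_integrand (x + 1) t)}.
  move=> t0; apply: continuousB; last exact: cg.
  by apply: continuousM; [exact: cst_continuous|exact: cg].
rewrite -(FTC_pos a0 ab (@is_derive_gamma_integrand x) cD).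
rewrite RintegralB //=; last exact: integrable_pos a0 (cg _).
  by rewrite RintegralZl //; [rewrite addrC subrK|exact: integrable_pos a0 (cg _)].
apply: integrable_pos => // t t0.
by apply: continuousM; [exact: cst_continuous|exact: cg].
Qed.

(** Comes from [ln s < s] at [s = t / (2 x)]. *)
Lemma gamma_integrand_bound x : 0 < x ->
  exists2 M : R, 0 < M & forall t, 0 < t -> gamma_integrand (x + 1) t <= M * expR (- (t / 2)).
Proof.
move=> x0; exists (expR (x * ln (2 * x))); first exact: expR_gt0.
move=> t t0; rewrite /gamma_integrand addrK /powR gt_eqF // -!expRD ler_expR.
have x20 : 0 < 2 * x by rewrite mulr_gt0.
have := ln_sublinear (divr_gt0 t0 x20).
rewrite ln_div ?posrE // => h.
have : x * (ln t - ln (2 * x)) <= x * (t / (2 * x)) by rewrite ler_wpM2l // ltW.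
have -> : x * (t / (2 * x)) = t / 2 by field; rewrite gt_eqF.
lra.
Qed.

(** The exponential endpoints make both boundary terms of the integration by
    parts O(1 / n). *)
Let lo n : R := expR (- n.+1%:R).
Let hi n : R := expR n.+1%:R.

Let lo_gt0 n : 0 < lo n. Proof. exact: expR_gt0. Qed.
Let lohi n : lo n < hi n. Proof. by rewrite ltr_expR gtrN // ltr0n. Qed.

Let truncated_gamma x n : R := \int[mu]_(t in `[lo n, hi n]) gamma_integrand x t.

Lemma expRN_le t : 0 < t -> expR (- t) <= t^-1.
Proof.
move=> t0; rewrite expRN lef_pV2 ?posrE ?expR_gt0 //.
by rewrite (le_trans _ (expR_ge1Dx t)) // lerDr.
Qed.

Lemma truncated_gamma_recurrence x : 0 < x -> exists2 K : R, 0 < K &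
  forall n, `|truncated_gamma (x + 1) n - x * truncated_gamma x n| <= K / n.+1%:R.
Proof.
move=> x0; have [M M0 hM] := gamma_integrand_bound x0.
exists (2 * M + x^-1) => [|n]; first by rewrite addr_gt0 ?mulr_gt0 ?invr_gt0.
rewrite /truncated_gamma gamma_integrand_parts // opprD addrA subrr add0r opprB.
apply: le_trans (ler_normB _ _) _.
rewrite !ger0_norm ?gamma_integrand_ge0 // mulrDl addrC; apply: lerD.
  apply: le_trans (hM _ (expR_gt0 _)) _; rewrite [2 * M]mulrC -!mulrA ler_pM2l //.
  apply: le_trans (expRN_le _) _; first by rewrite divr_gt0 // expR_gt0.
  rewrite invfM invrK mulrC ler_pM2l // lef_pV2 ?posrE ?expR_gt0 ?ltr0n //.
  by rewrite (le_trans _ (expR_ge1Dx _)) // lerDr.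
rewrite /gamma_integrand addrK /lo -expRM -invfM.
rewrite (@le_trans _ _ (expR (- n.+1%:R * x))) //.
  by rewrite ler_piMr ?expR_ge0 // -[leRHS]expR0 ler_expR oppr_le0 expR_ge0.
rewrite mulNr; apply: le_trans (expRN_le _) _; first by rewrite mulr_gt0.
by rewrite mulrC.
Qed.

(** For [x + 1] the integrand is below a multiple of [expR (- t / 2)] on the
    whole half-line; integration by parts carries the bound over to [x], whose
    integrand may be unbounded at [0]. *)
Lemma truncated_gamma_bounded x : 0 < x -> exists K, forall n, truncated_gamma x n <= K.
Proof.
move=> x0; have [M M0 hM] := gamma_integrand_bound x0.
have [K K0 hK] := truncated_gamma_recurrence x0; exists ((2 * M + K) / x) => n.
rewrite ler_pdivlMr // mulrC.
have h1 : truncated_gamma (x + 1) n <= 2 * M.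
  have cE t : 0 < t -> {for t, continuous (fun s : R => M * expR (- (s / 2)))}.
    move=> t0; apply: continuousM; first exact: cst_continuous.
    apply: continuous_comp; last exact: continuous_expR.
    by apply: continuousN; apply: continuousM => //; exact: cst_continuous.
  apply: (@le_trans _ _ (\int[mu]_(t in `[lo n, hi n]) (M * expR (- (t / 2))))).
    apply: le_Rintegral => //.
    + by apply: integrable_pos => // t; exact: continuous_gamma_integrand.
    + exact: integrable_pos.
    + move=> t /=; rewrite in_itv /= => /andP[+ _].
      by move=> /(lt_le_trans (lo_gt0 n)) /hM.
  have dF t : 0 < t ->
      is_derive t 1 (fun s : R => - (2 * M) * expR (- (s / 2))) (M * expR (- (t / 2))).
    by move=> t0; apply: is_derive_eq; rewrite /GRing.scale /=; field.
  rewrite (FTC_pos (lo_gt0 n) (lohi n) dF cE).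
  rewrite -mulrBr mulNr -mulrN opprB ler_piMr ?mulr_ge0 ?(ltW M0) //.
  rewrite lerBlDr -[leLHS]addr0 lerD ?expR_ge0 // -[leRHS]expR0 ler_expR.
  by rewrite oppr_le0 divr_ge0 // expR_ge0.
have h2 : x * truncated_gamma x n - truncated_gamma (x + 1) n <= K.
  rewrite (le_trans (ler_norm _)) // distrC (le_trans (hK n)) //.
  by rewrite ler_pdivrMr // ler_peMr ?(ltW K0) // ler1n.
by rewrite -[leLHS](subrK (truncated_gamma (x + 1) n)) addrC lerD.
Qed.

Lemma bigcup_lohi : \bigcup_n [set` `[lo n, hi n]] = [set` `]0, +oo[ : interval R].
Proof.
apply/seteqP; split=> [t [n _] /=|t /=]; rewrite !in_itv /= ?andbT.
  by move=> /andP[/(lt_le_trans (lo_gt0 n))].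
move=> t0; exists (Num.truncn `|ln t|) => //=; rewrite in_itv /=.
have := ltW (truncnS_gt `|ln t|); rewrite ler_norml => /andP[h1 h2].
have tp : t \in Num.pos by [].
by apply/andP; split; [rewrite -[leRHS](lnK tp)|rewrite -[leLHS](lnK tp)];
  rewrite ler_expR.
Qed.

Lemma truncated_gamma_EFin x n :
  (\int[mu]_(t in `[lo n, hi n]) (gamma_integrand x t)%:E)%E = (truncated_gamma x n)%:E.
Proof.
rewrite /truncated_gamma /Rintegral fineK //; apply: integrable_fin_num => //.
exact: integrable_pos (lo_gt0 n) (@continuous_gamma_integrand x).
Qed.

(** Monotone convergence in the extended reals; boundedness of the partial
    integrals makes the limit finite, so that it survives the projection to the
    reals in the definition of [Gamma]. *)
Lemma truncated_gamma_cvg x : 0 < x -> truncated_gamma x @ \oo --> Gamma x.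
Proof.
move=> x0; have [K hK] := truncated_gamma_bounded x0.
have cvgE : (truncated_gamma x n)%:E @[n --> \oo] -->
    (\int[mu]_(t in `]0%R, +oo[) (gamma_integrand x t)%:E)%E.
  under eq_fun do rewrite -truncated_gamma_EFin.
  rewrite -bigcup_lohi; apply: ge0_nondecreasing_set_cvg_integral => //.
  - apply/nondecreasing_seqP => n; apply/subsetPset => t /=; rewrite !in_itv /=.
    move=> /andP[h1 h2]; rewrite (le_trans _ h1) ?(le_trans h2) //.
      by rewrite ler_expR ler_nat.
    by rewrite ler_expR lerN2 ler_nat.
  - move=> n; apply/measurable_EFinP; apply: subspace_continuous_measurable_fun => //.
    exact: within_continuous_pos (lo_gt0 n) (@continuous_gamma_integrand x).
  - by move=> n t _; rewrite lee_fin gamma_integrand_ge0.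
have ge0 : (0 <= \int[mu]_(t in `]0%R, +oo[) (gamma_integrand x t)%:E)%E.
  by apply: integral_ge0 => t _; rewrite lee_fin gamma_integrand_ge0.
have fin : (\int[mu]_(t in `]0%R, +oo[) (gamma_integrand x t)%:E)%E \is a fin_num.
  rewrite ge0_fin_numE // (@le_lt_trans _ _ K%:E) ?ltry //.
  rewrite -(cvg_lim _ cvgE) //; apply: lime_le; first by apply/cvg_ex; eexists; exact: cvgE.
  by apply: nearW => n; rewrite lee_fin.
have := cvgE; rewrite -(fineK fin) => /fine_cvg; exact.
Qed.

Theorem Gamma_recurrence x : 0 < x -> Gamma (x + 1) = x * Gamma x.
Proof.
move=> x0; have [K K0 hK] := truncated_gamma_recurrence x0.
have x1 : 0 < x + 1 by rewrite addr_gt0.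
have c1 : (truncated_gamma (x + 1) n - x * truncated_gamma x n) @[n --> \oo] --> Gamma (x + 1) - x * Gamma x.
  by apply: cvgB; [exact: truncated_gamma_cvg|apply: cvgMl_tmp; exact: truncated_gamma_cvg].
have c0 : (truncated_gamma (x + 1) n - x * truncated_gamma x n) @[n --> \oo] --> (0 : R).
  apply/cvgrPdist_le => e e0; exists (Num.truncn (K / e)) => // n /= Nn.
  rewrite sub0r normrN (le_trans (hK n)) // ler_pdivrMr // mulrC -ler_pdivrMr //.
  by rewrite (le_trans (ltW (truncnS_gt _))) // ler_nat.
by apply/eqP; rewrite -subr_eq0 (cvg_unique _ c1 c0).
Qed.

Theorem Gamma_gt0 x : 0 < x -> 0 < Gamma x.
Proof.
(* [c] is a lower bound of the integrand between [lo 0 = 1 / e] and [hi 0 = e]. *)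
move=> x0; pose c := expR (- (`|x - 1| + hi 0)); have c0 : 0 < c by exact: expR_gt0.
have cg := @continuous_gamma_integrand x.
have cid t : 0 < t -> {for t, continuous (fun=> c : R)}.
  by move=> _; exact: cst_continuous.
have part0 : forall n, truncated_gamma x 0 <= truncated_gamma x n.
  move=> n; rewrite -lee_fin -[X in (X <= _)%E](truncated_gamma_EFin x 0).
  rewrite -[X in (_ <= X)%E](truncated_gamma_EFin x n).
  apply: ge0_subset_integral => //.
  - apply/measurable_EFinP; apply: subspace_continuous_measurable_fun => //.
    exact: within_continuous_pos (lo_gt0 n) cg.
  - by move=> t _; rewrite lee_fin gamma_integrand_ge0.
  - move=> t /=; rewrite !in_itv /= => /andP[h1 h2].
    rewrite (le_trans _ h1) ?(le_trans h2) //; first by rewrite ler_expR ler_nat.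
    by rewrite ler_expR lerN2 ler_nat.
apply: (@lt_le_trans _ _ (truncated_gamma x 0)); last first.
  have pc := truncated_gamma_cvg x0; rewrite -(cvg_lim _ pc) //.
  apply: limr_ge; first by apply/cvg_ex; exists (Gamma x).
  by apply: nearW => n; exact: part0.
apply: (@lt_le_trans _ _ (\int[mu]_(t in `[lo 0, hi 0]) c)).
  have dF t : 0 < t -> is_derive t 1 (fun s : R => c * s) c.
    by move=> t0; apply: is_derive_eq; rewrite /GRing.scale /= mulr1.
  rewrite (FTC_pos (lo_gt0 0) (lohi 0) dF cid) -mulrBr.
  by rewrite mulr_gt0 // subr_gt0.
apply: le_Rintegral => //.
- exact: integrable_pos (lo_gt0 0) cid.
- exact: integrable_pos (lo_gt0 0) cg.
move=> t /=; rewrite in_itv /= => /andP[t1 t2]; have t0 := lt_le_trans (lo_gt0 0) t1.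
rewrite /gamma_integrand /powR gt_eqF // -expRD ler_expR opprD lerD ?lerN2 //.
have lnt : `|ln t| <= 1.
  rewrite ler_norml -(expRK (- 1)) -{2}(expRK 1) !ler_ln ?posrE ?expR_gt0 //.
  by rewrite t1 t2.
rewrite lerNl (le_trans (ler_norm _)) // normrN normrM -[leRHS]mulr1.
by rewrite ler_wpM2l.
Qed.

Theorem pochhammerE x n : 0 < x -> pochhammer x n = rising x n.
Proof.
move=> x0; have G0 := Gamma_gt0 x0.
elim: n => [|n IHn]; first by rewrite /pochhammer /rising big_ord0 addr0 divff ?gt_eqF.
rewrite risingS -IHn /pochhammer -natr1 addrA Gamma_recurrence ?ltr_pwDl //.
by rewrite [RHS]mulrC mulrA.
Qed.

End GammaFunction.

(** * Positivity of moment functionals *)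

Section Bernstein.
Variable R : realType.
Implicit Types f : nat -> R.

Lemma iter_decrement_ge0 n f k :
  completely_monotone f -> 0 <= iter n (@decrement R) f k.
Proof.
move=> cmf; have : monotone_upto n f by [].
elim: n f {cmf} => [|n IHn] f; first by case=> + _; exact.
by case=> _ df; rewrite iterSr; exact: IHn.
Qed.

(** With [E] the shift and [1 - E] the decrement, this is the binomial expansion
    of [((1 - E) + E) ^ N = 1]. *)
Lemma sum_iter_decrement N f k :
  \sum_(i < N.+1) 'C(N, i)%:R * iter (N - i) (@decrement R) f (i + k)%N = f k.
Proof.
elim: N f k => [|N IHN] f k; first by rewrite big_ord1 subn0 /= mul1r.
rewrite -[RHS](subrK (f k.+1)) -/(decrement f k) -[in RHS]IHN -(IHN f k.+1).
rewrite big_ord_recl bin0 subn0 mul1r.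
under eq_bigr => i _ do rewrite lift0 binS natrD mulrDl subSS addSnnS.
rewrite big_split /= addrA; congr (_ + _).
rewrite big_ord_recr /= bin_small // mul0r addr0.
rewrite [in RHS]big_ord_recl bin0 subn0 mul1r -iterSr; congr (_ + _).
apply: eq_bigr => i _; rewrite lift0 addSnnS -iterSr.
by rewrite subnSK.
Qed.

Lemma bin_mul_bin N i m :
  (i <= N)%N -> ('C(N + m, i + m) * 'C(i + m, m) = 'C(N + m, m) * 'C(N, i))%N.
Proof.
move=> iN; apply/eqP.
rewrite -(@eqn_pmul2r (m`! * i`! * (N - i)`!)) ?muln_gt0 ?fact_gt0 //.
have E1 := @bin_fact (N + m) (i + m) ltac:(by rewrite leq_add2r).
have E2 := @bin_fact (i + m) m ltac:(by rewrite leq_addl).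
have E3 := @bin_fact (N + m) m ltac:(by rewrite leq_addl).
have E4 := @bin_fact N i iN.
rewrite subnDr in E1; rewrite addnK in E2; rewrite addnK in E3.
apply/eqP; transitivity (N + m)`!.
  by rewrite -E1 -E2 !mulnA.
by rewrite -E3 -E4; ring.
Qed.

(** The value at the Bernstein polynomial ['C(n, j) x^j (1 - x)^(n - j)] of the
    linear functional that sends [x^k] to [f k]. *)
Definition bernstein_weight f (n j : nat) : R :=
  'C(n, j)%:R * iter (n - j) (@decrement R) f j.

(** The measure with masses [bernstein_weight f n j] at the points [j / n] has
    [f m] as its moment of order [m], up to replacing [(j / n)^m] by a ratio of
    binomial coefficients. *)
Lemma bernstein_moment f n m : (m <= n)%N ->
  \sum_(j < n.+1) bernstein_weight f n j * ('C(j, m)%:R / 'C(n, m)%:R) = f m.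
Proof.
move=> /subnK <-; set N := (n - m)%N.
rewrite -(big_mkord xpredT (fun j => bernstein_weight f (N + m) j *
  ('C(j, m)%:R / 'C(N + m, m)%:R))).
rewrite (big_cat_nat (n := m)) //=; last by rewrite leqW ?leq_addl.
rewrite big_nat big1 ?add0r => [|j /andP[_ jm]]; last first.
  by rewrite bin_small // mul0r mulr0.
rewrite -[X in \sum_(X <= _ < _) _]add0n big_addn -addSn addnK big_mkord.
rewrite -[RHS](sum_iter_decrement N); apply: eq_bigr => -[i /= iN _].
rewrite /bernstein_weight subnDr.
have c0 : 'C(N + m, m)%:R != 0 :> R by rewrite pnatr_eq0 -lt0n bin_gt0 leq_addl.
have E : 'C(N + m, i + m)%:R * 'C(i + m, m)%:R =
    'C(N + m, m)%:R * 'C(N, i)%:R :> R by rewrite -!natrM bin_mul_bin.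
by rewrite mulrAC mulrA E ['C(N + m, m)%:R * _]mulrC mulfK.
Qed.

(** Both sides are products of [m] factors in [[0, 1]] that differ pairwise by at
    most [i / n], [i < m]. *)
Lemma bin_ratio_approx n m j : (m <= n)%N -> (0 < n)%N -> (j <= n)%N ->
  `|'C(j, m)%:R / 'C(n, m)%:R - (j%:R / n%:R) ^+ m| <= (m ^ 2)%:R / n%:R :> R.
Proof.
move=> mn n0 jn; have nR0 : 0 < n%:R :> R by rewrite ltr0n.
elim: m mn => [|m IHm] mn; first by rewrite !bin0 divr1 expr0 subrr normr0 mul0r.
have c0 k : (k <= n)%N -> 0 < 'C(n, k)%:R :> R by move=> kn; rewrite ltr0n bin_gt0.
have nm0 : 0 < (n - m)%:R :> R by rewrite ltr0n subn_gt0.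
pose A : R := 'C(j, m)%:R / 'C(n, m)%:R; pose x : R := j%:R / n%:R.
rewrite -/x in IHm *; rewrite -/A in IHm.
pose r : R := (j - m)%:R / (n - m)%:R.
have -> : 'C(j, m.+1)%:R / 'C(n, m.+1)%:R = A * r.
  have m1 : m.+1%:R != 0 :> R by rewrite pnatr_eq0.
  have E k : 'C(k, m.+1)%:R = (k - m)%:R * 'C(k, m)%:R / m.+1%:R :> R.
    by rewrite -natrM -mul_bin_left natrM mulrAC divff // mul1r.
  by rewrite !E /A /r; field; rewrite nat1r m1 !gt_eqF ?c0 // ltnW.
have A01 : 0 <= A <= 1.
  rewrite divr_ge0 ?ler0n //= ler_pdivrMr ?c0 1?ltnW // mul1r ler_nat.
  exact: leq_bin2l.
have x01 : 0 <= x <= 1.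
  by rewrite divr_ge0 ?ler0n //= ler_pdivrMr // mul1r ler_nat.
have rx : `|r - x| <= m%:R / n%:R.
  rewrite /r /x; have [jm|mj] := leqP j m.
    rewrite (eqP (_ : j - m == 0)%N) ?subn_eq0 // mul0r sub0r normrN.
    by rewrite ger0_norm ?divr_ge0 ?ler0n // ler_pM2r ?invr_gt0 // ler_nat.
  have -> : (j - m)%:R / (n - m)%:R - j%:R / n%:R =
    - ((n - j)%:R / (n - m)%:R * (m%:R / n%:R)) :> R.
    rewrite !natrB // ?(ltnW mj) ?(ltnW mn) //.
    by field; rewrite -natrB ?(ltnW mn) // !gt_eqF.
  rewrite normrN ger0_norm ?mulr_ge0 ?divr_ge0 ?ler0n // ler_piMl //.
  by rewrite ler_pdivrMr // mul1r ler_nat leq_sub2l // ltnW.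
have {}IHm := IHm (ltnW mn).
rewrite exprSr.
have -> : A * r - x ^+ m * x = A * (r - x) + x * (A - x ^+ m) by ring.
apply: le_trans (ler_normD _ _) _; rewrite (normrM A) (normrM x).
apply: (@le_trans _ _ (m%:R / n%:R + (m ^ 2)%:R / n%:R)).
  case/andP: A01 => A0 A1; case/andP: x01 => x0 x1.
  apply: lerD; first by rewrite (ger0_norm A0) -[leRHS]mul1r ler_pM.
  by rewrite (ger0_norm x0) -[leRHS]mul1r ler_pM.
rewrite -mulrDl ler_pM2r ?invr_gt0 // -natrD ler_nat.
by rewrite -!mulnn mulSn mulnS leq_addl.
Qed.

Local Open Scope complex_scope.

Lemma normc_real (x : R) : `|x%:C| = `|x|%:C.
Proof. by rewrite normc_def /= expr0n addr0 sqrtr_sqr. Qed.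

(** Nonnegative elements of [R[i]] are real, so this closedness also covers the
    vanishing of the imaginary part. *)
Lemma complex_ge0_approx (S : R[i]) :
    (forall e : R, 0 < e -> exists2 T, 0 <= T & `|S - T| <= e%:C) ->
  0 <= S.
Proof.
move=> hS; have h e : 0 < e -> `|complex.Im S| <= e /\ - e <= complex.Re S.
  move=> /hS[T]; rewrite lecE /= => /andP[/eqP iT rT] ST.
  have rST : `|complex.Re (S - T)| <= e.
    by rewrite -lecR (le_trans _ ST) ?normc_ge_Re.
  have iST : `|complex.Im (S - T)| <= e.
    rewrite -normrN -ReiNIm -lecR (le_trans (normc_ge_Re _)) //.
    by rewrite normrM [X in _ * X]normc_def /= expr0n expr1n add0r sqrtr1 mulr1.
  move: rST iST; case: (S) (T) iT rT => a b [c d] /= -> c0.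
  rewrite subr0 => ac ->; split=> //.
  by move: ac; rewrite ler_norml => /andP[+ _]; lra.
rewrite lecE /=; apply/andP; split.
  rewrite -normr_le0; apply/ler_addgt0Pl => e e0; rewrite addr0.
  by have [] := h _ e0.
by apply/ler_addgt0Pl => e e0; have [_] := h _ e0; lra.
Qed.

(** The half of Hausdorff's moment theorem that is needed: the functional sending
    [x^k] to [f k] is positive on polynomials that are nonnegative on [[0, 1]],
    being a limit of finite sums of point evaluations with the Bernstein masses. *)
Lemma completely_monotone_functional_ge0 f (q : {poly R[i]}) :
    completely_monotone f ->
    (forall x : R, 0 <= x <= 1 -> 0 <= q.[x%:C]) ->
  0 <= \sum_(i < size q) (f i)%:C * q`_i.
Proof.
move=> cmf q0; apply: complex_ge0_approx => e e0.
pose w n j := bernstein_weight f n j.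
have w0 n j : 0 <= w n j by rewrite mulr_ge0 ?ler0n ?iter_decrement_ge0.
have sw n : \sum_(j < n.+1) w n j = f 0.
  rewrite -(@bernstein_moment f n 0) //; apply: eq_bigr => j _.
  by rewrite !bin0 divr1 mulr1.
pose x n (j : nat) : R := j%:R / n%:R.
pose A n i (j : nat) : R := 'C(j, i)%:R / 'C(n, i)%:R.
(* [K / n] bounds the error made in replacing moments by point evaluations. *)
pose K : R := \sum_(i < size q) complex.Re `|q`_i| * (f 0 * (i ^ 2)%:R).
have [n] : exists n, [/\ (size q <= n)%N, (0 < n)%N & K / n%:R <= e].
  exists (maxn (Num.truncn (K / e)).+1 (size q)).
  rewrite leq_maxr leq_max ltn0Sn; split=> //.
  have n0 : 0 < (maxn (Num.truncn (K / e)).+1 (size q))%:R :> R.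
    by rewrite ltr0n leq_max ltn0Sn.
  rewrite ler_pdivrMr // mulrC -ler_pdivrMr //.
  apply: (@le_trans _ _ (Num.truncn (K / e)).+1%:R).
    by rewrite ltW // truncnS_gt.
  by rewrite ler_nat leq_maxl.
move=> [qn n0 Kn].
exists (\sum_(j < n.+1) (w n j)%:C * q.[(x n j)%:C]).
  apply: sumr_ge0 => -[j /= jn] _; rewrite mulr_ge0 ?ler0c // q0 //.
  by rewrite /x divr_ge0 ?ler0n //= ler_pdivrMr ?ltr0n // mul1r ler_nat.
have -> : \sum_(j < n.+1) (w n j)%:C * q.[(x n j)%:C] =
  \sum_(i < size q) (\sum_(j < n.+1) w n j * x n j ^+ i)%:C * q`_i.
  under eq_bigr => j _ do rewrite horner_coef mulr_sumr.
  rewrite exchange_big /=; apply: eq_bigr => i _.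
  rewrite rmorph_sum /= mulr_suml; apply: eq_bigr => j _.
  by rewrite [in RHS]rmorphM [in RHS]rmorphXn /=; ring.
rewrite -sumrB; under eq_bigr => i _ do rewrite -mulrBl -rmorphB.
apply: le_trans (ler_norm_sum _ _ _) _.
apply: (@le_trans _ _ (K / n%:R)%:C); last by rewrite lecR.
rewrite /K mulr_suml rmorph_sum; apply: ler_sum => -[i /= iq] _.
have qE : `|q`_i| = (complex.Re `|q`_i|)%:C by rewrite normc_def.
rewrite normrM normc_real [X in X <= _]mulrC -mulrA rmorphM /= -qE.
rewrite ler_wpM2l // lecR -(@bernstein_moment f n i); last first.
  by rewrite (leq_trans (ltnW iq)).
rewrite -sumrB; under eq_bigr => j _ do rewrite -mulrBr.
rewrite -mulrA -(sw n) mulr_suml.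
apply: le_trans (ler_norm_sum _ _ _) _; apply: ler_sum => -[j /= jn] _.
rewrite normrM ger0_norm //; apply: ler_wpM2l => //.
by apply: bin_ratio_approx => //; exact: leq_trans (ltnW iq) qn.
Qed.

End Bernstein.

(** * Limits of complex sequences *)

Section ComplexLimits.
Variable R : realType.
Local Notation C := R[i].
Local Open Scope complex_scope.

Lemma complex_gt0P (e : C) : 0 < e -> exists2 r : R, 0 < r & e = r%:C.
Proof.
rewrite ltcE /= => /andP[/eqP ie re]; exists (complex.Re e) => //.
by case: e ie re => a b /= -> _.
Qed.

Lemma complex_ge0P (e : C) : 0 <= e -> exists2 r : R, 0 <= r & e = r%:C.
Proof.
rewrite lecE /= => /andP[/eqP ie re]; exists (complex.Re e) => //.
by case: e ie re => a b /= -> _.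
Qed.

Lemma complex_archimedean (e : C) : 0 < e ->
  exists N : nat, forall n, (N <= n)%N -> n.+1%:R^-1 <= e.
Proof.
move=> /complex_gt0P[r r0 ->]; exists (Num.truncn r^-1) => n Nn.
have -> : n.+1%:R^-1 = (n.+1%:R^-1)%:C :> C by rewrite fmorphV rmorph_nat.
rewrite lecR -[leRHS]invrK lef_pV2 ?posrE ?invr_gt0 //.
by rewrite (le_trans (ltW (truncnS_gt _))) // ler_nat.
Qed.

Lemma complex_le_addgt0 (x y : C) :
  (forall e, 0 < e -> x <= y + e) -> x <= y.
Proof.
move=> h; rewrite -subr_ge0; apply: complex_ge0_approx => e e0.
exists (y + e%:C - x); first by rewrite subr_ge0 h // ltcR.
have -> : y - x - (y + e%:C - x) = - e%:C by ring.
by rewrite normrN normc_real gtr0_norm.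
Qed.

Lemma cvgn_complexP (V : normedModType C) (u : nat -> V) (l : V) :
  (forall e : C, 0 < e -> exists N, forall n, (N <= n)%N -> `|l - u n| <= e) <->
  u @ \oo --> l.
Proof.
split=> [h|/cvgrPdist_le h e e0].
  apply/cvgrPdist_le => e e0; have [N hN] := h e e0.
  by exists N => // n; exact: hN.
by have [N _ hN] := h e e0; exists N => n; exact: hN.
Qed.

Lemma cvgn_scalarP (u : nat -> C) (l : C) :
  (forall e : C, 0 < e -> exists N, forall n, (N <= n)%N -> `|l - u n| <= e) <->
  u @ \oo --> (l : C^o).
Proof. exact: (@cvgn_complexP C^o). Qed.

(** Stated for an arbitrary function [nrm] so as to apply to the seminorm of a
    space that carries no topology yet. *)
Definition is_cauchy (V : zmodType) (nrm : V -> C) (u : nat -> V) :=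
  forall e : C, 0 < e -> exists N, forall i j,
    (N <= i)%N -> (N <= j)%N -> nrm (u i - u j) <= e.

Lemma cvgn_is_cauchy (V : normedModType C) (u : nat -> V) (l : V) :
  u @ \oo --> l -> is_cauchy (@Num.norm _ V) u.
Proof.
move=> /cvgn_complexP ul e e0.
have [N hN] := ul (e / 2) (divr_gt0 e0 (ltr0Sn _ _)).
exists N => i j iN jN; rewrite [e]splitr -[u i - u j](subrKA l) addrC.
by apply: le_trans (ler_normD _ _) _; rewrite lerD ?hN // distrC hN.
Qed.

Lemma is_cauchy_cvgn (V : completeNormedModType C) (u : nat -> V) :
  is_cauchy (@Num.norm _ V) u -> exists l : V, u @ \oo --> l.
Proof.
move=> uc; suff /cvg_ex[l ul] : cvgn u by exists l.
apply/cauchy_cvgP/cauchy_ballP => e e0.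
have [N hN] := uc _ (divr_gt0 e0 (ltr0Sn _ 1)).
rewrite near_map2; exists ([set n | (N <= n)%N], [set n | (N <= n)%N]).
  by split; exists N.
move=> [i j] /= [Ni Nj]; rewrite -ball_normE /ball_ /=.
apply: le_lt_trans (hN _ _ Ni Nj) _.
by rewrite ltr_pdivrMr // ltr_pMr // ltr1n.
Qed.

(** Completeness of [R[i]] follows from that of [R] through real and imaginary
    parts. *)
Lemma complex_is_cauchy_cvgn (u : nat -> C) :
  is_cauchy (@Num.norm _ C) u -> exists l : C, u @ \oo --> (l : C^o).
Proof.
move=> uc.
have cauchyR (p : C -> R) : (forall z, `|p z|%:C <= `|z|) ->
    (forall x y, p (x - y) = p x - p y) -> exists l : R, p \o u @ \oo --> l.
  move=> pN pB; suff /cvg_ex[l ul] : cvgn (p \o u) by exists l.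
  apply/cauchy_cvgP/cauchy_ballP => e e0.
  have /uc[N hN] : 0 < (e / 2)%:C by rewrite ltcR divr_gt0.
  rewrite near_map2; exists ([set n | (N <= n)%N], [set n | (N <= n)%N]); first by split; exists N.
  move=> [i j] /= [Ni Nj]; rewrite -ball_normE /ball_ /= -pB.
  apply: (@le_lt_trans _ _ (e / 2)); last by rewrite gtr_pMr // invf_lt1 // ltr1n.
  by rewrite -lecR (le_trans (pN _)) // hN.
have [] := cauchyR (@complex.Re R) (@normc_ge_Re R).
  by move=> [? ?] [? ?].
move=> a ha.
have [||b hb] := cauchyR (@complex.Im R).
- move=> z; rewrite -normrN -ReiNIm (le_trans (normc_ge_Re _)) //.
  by rewrite normrM [X in _ * X]normc_def /= expr0n expr1n add0r sqrtr1 mulr1.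
- by move=> [? ?] [? ?].
exists (a +i* b); apply/cvgn_scalarP => e /complex_gt0P[r r0 ->].
have r20 : 0 < r / 2 by rewrite divr_gt0.
move/cvgrPdist_le/(_ _ r20) : ha => [N1 _ h1].
move/cvgrPdist_le/(_ _ r20) : hb => [N2 _ h2].
exists (maxn N1 N2) => n; rewrite geq_max => /andP[/h1 /= {}h1 /h2 /= {}h2].
rewrite [r]splitr.
case: (u n) h1 h2 => c d /= h1 h2.
rewrite -[_ - _]/((a - c) +i* (b - d)) [_ +i* _]complexE /=.
apply: le_trans (ler_normD _ _) _; rewrite normrM normc_real.
rewrite [X in X * _]normc_def /= expr0n expr1n add0r sqrtr1 mul1r normc_real.
by rewrite rmorphD; apply: lerD; rewrite lecR.
Qed.

Lemma cvgn_complex_ge0 (N : nat) (u : nat -> C) (l : C) :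
  (forall n, (N <= n)%N -> 0 <= u n) -> u @ \oo --> (l : C^o) -> 0 <= l.
Proof.
move=> u0 /cvgn_scalarP ul; apply: complex_ge0_approx => e e0.
have [|N' hN'] := ul e%:C; first by rewrite ltcR.
exists (u (maxn N N')); first by rewrite u0 // leq_maxl.
by apply: hN'; rewrite leq_maxr.
Qed.

Lemma cvgn_complex_le (N : nat) (u : nat -> C) (l M : C) :
  (forall n, (N <= n)%N -> u n <= M) -> u @ \oo --> (l : C^o) -> l <= M.
Proof.
move=> uM /cvgn_scalarP ul; rewrite -subr_ge0.
apply: (@cvgn_complex_ge0 N (fun n => M - u n)) => [n Nn|].
  by rewrite subr_ge0 uM.
apply/cvgn_scalarP => e /ul[N' hN']; exists N' => n /hN'.
have -> : M - l - (M - u n) = - (l - u n) by ring.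
by rewrite normrN.
Qed.

Lemma cvgn_conj (u : nat -> C) (l : C) :
  u @ \oo --> (l : C^o) -> (fun n => (u n)^*%R) @ \oo --> (l^*%R : C^o).
Proof.
move=> /cvgn_scalarP ul; apply/cvgn_scalarP => e /ul[N hN].
by exists N => n /hN; rewrite -rmorphB norm_conjC.
Qed.

Lemma cvgn_scalarD (u v : nat -> C) (l m : C) :
  u @ \oo --> (l : C^o) -> v @ \oo --> (m : C^o) ->
  (fun n => u n + v n) @ \oo --> (l + m : C^o).
Proof. by move=> ul vm; apply: (@cvgD C C^o) ul vm. Qed.

Lemma cvgn_scalarM (a : C) (u : nat -> C) (l : C) :
  u @ \oo --> (l : C^o) -> (fun n => a * u n) @ \oo --> (a * l : C^o).
Proof. by move=> ul; apply: cvgMl_tmp ul. Qed.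

Lemma cvgn_unique (V : normedModType C) (u : nat -> V) (l l' : V) :
  u @ \oo --> l -> u @ \oo --> l' -> l = l'.
Proof. by move=> ul ul'; exact: (cvg_unique _ ul ul'). Qed.

(** A Cauchy filter contains balls of radius [1 / (n + 1)]; their centers form a
    Cauchy sequence, whose limit is a limit of the filter. *)
Lemma sequentially_complete (V : normedModType C) :
    (forall u : nat -> V, is_cauchy (@Num.norm _ V) u -> exists l : V, u @ \oo --> l) ->
  forall F : set_system V, ProperFilter F -> cauchy F -> cvg F.
Proof.
move=> Vc F FF /cauchyP Fc.
have e0 n : 0 < n.+1%:R^-1 :> C by rewrite invr_gt0.
have /choice[u hu] : forall n, exists x, F (ball x (n.+1%:R^-1 : C)).
  by move=> n; exact: Fc.
have dist n m : `|u n - u m| <= n.+1%:R^-1 + m.+1%:R^-1.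
  have : F (ball (u n) (n.+1%:R^-1 : C) `&` ball (u m) (m.+1%:R^-1 : C)).
    exact: filterI.
  move=> /filter_ex[z []].
  rewrite -ball_normE /ball_ /= => h1 h2.
  rewrite -[u n - u m](subrKA z).
  by apply: le_trans (ler_normD _ _) _; rewrite lerD ?ltW // distrC.
have [|l ul] := Vc u.
  move=> e e1; have [N hN] := complex_archimedean (divr_gt0 e1 (ltr0Sn _ 1)).
  exists N => i j iN jN; apply: le_trans (dist _ _) _.
  by rewrite [leRHS]splitr lerD // hN.
apply/cvg_ex; exists l; apply/cvgrPdist_le => e e1.
have [N1 hN1] := complex_archimedean (divr_gt0 e1 (ltr0Sn _ 1)).
have /cvgn_complexP/(_ _ (divr_gt0 e1 (ltr0Sn _ 1)))[N2 hN2] := ul.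
pose N := maxn N1 N2; apply: filterS (hu N) => z.
rewrite -ball_normE /ball_ /= => h; rewrite -[l - z](subrKA (u N)).
apply: le_trans (ler_normD _ _) _; rewrite [leRHS]splitr lerD //.
  by rewrite hN2 // leq_maxr.
by rewrite (le_trans (ltW h)) // hN1 // leq_maxl.
Qed.

End ComplexLimits.

(** * Semi-inner product spaces *)

Section SemiInnerProduct.
Variable R : realType.
Local Notation C := R[i].

Record semi_inner (E : lmodType C) := SemiInner {
  sform :> E -> E -> C ;
  sform_linear : forall a x y z,
    sform (a *: x + y) z = a * sform x z + sform y z ;
  sform_conj : forall x y, sform y x = (sform x y)^*%R ;
  sform_ge0 : forall x, 0 <= sform x x }.

Variables (E : lmodType C) (B : semi_inner E).
Implicit Types x y z : E.

Lemma sformDl x y z : B (x + y) z = B x z + B y z.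
Proof. by rewrite -[x]scale1r sform_linear mul1r scale1r. Qed.

Lemma sform0l z : B 0 z = 0.
Proof. by apply: (addrI (B 0 z)); rewrite -sformDl !addr0. Qed.

Lemma sformZl a x z : B (a *: x) z = a * B x z.
Proof. by rewrite -[a *: x]addr0 sform_linear sform0l addr0. Qed.

Lemma sformNl x z : B (- x) z = - B x z.
Proof. by rewrite -scaleN1r sformZl mulN1r. Qed.

Lemma sformBl x y z : B (x - y) z = B x z - B y z.
Proof. by rewrite sformDl sformNl. Qed.

Lemma sformDr x y z : B x (y + z) = B x y + B x z.
Proof. by rewrite !(sform_conj B _ x) sformDl rmorphD. Qed.

Lemma sform0r z : B z 0 = 0.
Proof. by rewrite sform_conj sform0l rmorph0. Qed.

Lemma sformZr a x z : B x (a *: z) = a^*%R * B x z.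
Proof. by rewrite !(sform_conj B _ x) sformZl rmorphM. Qed.

Lemma sformNr x z : B x (- z) = - B x z.
Proof. by rewrite -scaleN1r sformZr rmorphN rmorph1 mulN1r. Qed.

Lemma sformBr x y z : B x (y - z) = B x y - B x z.
Proof. by rewrite !(sform_conj B _ x) sformBl rmorphB. Qed.

Definition sform_rules :=
  (sformDl, sformDr, sformNl, sformNr, sformZl, sformZr, sform0l, sform0r).

Definition snorm x : C := sqrtC (B x x).

Lemma snorm_ge0 x : 0 <= snorm x.
Proof. by rewrite sqrtC_ge0 sform_ge0. Qed.

Lemma snorm_sqr x : snorm x ^+ 2 = B x x.
Proof. by rewrite sqrtCK. Qed.

(** The form may be degenerate, so that [y] can be nonzero with [B y y = 0]; then
    letting the multiple of [y] grow forces [B x y = 0]. *)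
Lemma sform_cauchy_schwarz_sqr x y : `|B x y| ^+ 2 <= B x x * B y y.
Proof.
set b := B x y; have Byx : B y x = b^*%R by rewrite sform_conj.
have h t : 0 <= B x x - t^*%R * b - t * b^*%R + t * t^*%R * B y y.
  have := sform_ge0 B (x - t *: y); rewrite !sform_rules Byx.
  by congr (_ <= _); rewrite -/b; ring.
have [y0|y0] := eqVneq (B y y) 0.
  rewrite y0 mulr0; have [->|b0] := eqVneq b 0; first by rewrite normr0 expr0n.
  pose n : C := b * b^*%R; have n0 : n != 0.
    by rewrite mulf_neq0 // conjC_eq0.
  (* With this multiple of [b], the square of [x - (s * b) *: y] would be [- 1]. *)
  pose s := (B x x + 1) / (2 * n).
  have := h (s * b); rewrite y0 mulr0 addr0 rmorphM /=.
  have -> : s^*%R = s.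
    have nr : n^*%R = n by rewrite /n rmorphM /= conjCK mulrC.
    by rewrite fmorph_div rmorphD /= rmorph1 -sform_conj rmorphM /= conjC_nat nr.
  have -> : B x x - s * b^*%R * b - s * b * b^*%R = - 1.
    have -> : B x x - s * b^*%R * b - s * b * b^*%R = B x x - 2 * s * n.
      by rewrite /n; ring.
    by rewrite /s; field.
  by rewrite ler0N1.
have y1 : 0 < B y y by rewrite lt_def y0 sform_ge0.
have Byr : (B y y)^*%R = B y y by rewrite -sform_conj.
have := h (b / B y y); rewrite rmorphM /= fmorphV /= Byr.
have -> : B x x - b^*%R / B y y * b - b / B y y * b^*%R +
    b / B y y * (b^*%R / B y y) * B y y = B x x - `|b| ^+ 2 / B y y.
  by rewrite normCK; field.
by rewrite subr_ge0 ler_pdivrMr.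
Qed.

Lemma sform_cauchy_schwarz x y : `|B x y| <= snorm x * snorm y.
Proof.
rewrite -(@ler_pXn2r _ 2) ?nnegrE ?mulr_ge0 ?snorm_ge0 // exprMn !snorm_sqr.
exact: sform_cauchy_schwarz_sqr.
Qed.

Lemma snormZ a x : snorm (a *: x) = `|a| * snorm x.
Proof.
apply/eqP; rewrite -(@eqrXn2 _ 2) ?mulr_ge0 ?snorm_ge0 //.
by rewrite exprMn !snorm_sqr !sform_rules normCK mulrA.
Qed.

Lemma ler_snormD x y : snorm (x + y) <= snorm x + snorm y.
Proof.
rewrite -(@ler_pXn2r _ 2) ?nnegrE ?addr_ge0 ?snorm_ge0 //.
rewrite sqrrD !snorm_sqr !sform_rules addrA lerD2r -addrA lerD2l.
rewrite [B y x]sform_conj.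
apply: le_trans (real_ler_norm _) _.
  by apply/CrealP; rewrite rmorphD /= conjCK addrC.
apply: le_trans (ler_normD _ _) _; rewrite norm_conjC -mulr2n.
by rewrite lerMn2r sform_cauchy_schwarz.
Qed.

Lemma sform_diff x x' y y' : `|B x y - B x' y'| <=
  snorm (x - x') * snorm y + snorm x' * snorm (y - y').
Proof.
have -> : B x y - B x' y' = B (x - x') y + B x' (y - y').
  by rewrite !sform_rules; ring.
by apply: le_trans (ler_normD _ _) _; rewrite lerD // sform_cauchy_schwarz.
Qed.

Local Notation cauchy_seq := (is_cauchy snorm).

Lemma cauchy_bounded e : cauchy_seq e ->
  exists M, 0 < M /\ forall n, snorm (e n) <= M.
Proof.
move=> /(_ 1 ltr01)[N hN].
pose M := \sum_(i < N.+1) snorm (e i) + 1; exists M.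
have s0 n : 0 <= \sum_(i < n) snorm (e i) by apply: sumr_ge0 => i _; exact: snorm_ge0.
have M0 : 0 < M by rewrite ltr_wpDl.
split=> // n; have le_part k : (k <= N)%N -> snorm (e k) <= \sum_(i < N.+1) snorm (e i).
  move=> kN; rewrite (bigD1 (Ordinal (kN : (k < N.+1)%N))) //= lerDl.
  by apply: sumr_ge0 => i _; exact: snorm_ge0.
have [nN|Nn] := leqP n N; first by rewrite (le_trans (le_part _ nN)) // lerDl.
rewrite -[e n](subrK (e N)) addrC (le_trans (ler_snormD _ _)) // lerD ?le_part //.
by rewrite hN // ltnW.
Qed.

Lemma cauchy_linear a e h : cauchy_seq e -> cauchy_seq h ->
  cauchy_seq (fun n => a *: e n + h n).
Proof.
move=> ce ch eps eps0; have a0 : 0 < `|a| + 1 by rewrite ltr_wpDl.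
have e1 : 0 < eps / 2 / (`|a| + 1) by rewrite !divr_gt0.
have [N1 h1] := ce _ e1; have [N2 h2] := ch _ (divr_gt0 eps0 (ltr0Sn _ 1)).
exists (maxn N1 N2) => i j; rewrite !geq_max => /andP[i1 i2] /andP[j1 j2].
have -> : a *: e i + h i - (a *: e j + h j) = a *: (e i - e j) + (h i - h j).
  by rewrite scalerBr opprD addrACA.
rewrite (le_trans (ler_snormD _ _)) // [eps]splitr lerD ?h2 // snormZ.
apply: le_trans (ler_wpM2r (snorm_ge0 _) (_ : _ <= `|a| + 1)) _.
  by rewrite lerDl.
by rewrite mulrC -ler_pdivlMr // h1.
Qed.

Lemma cauchy_cst x : cauchy_seq (fun=> x).
Proof.
move=> eps eps0; exists 0 => i j _ _.
by rewrite subrr /snorm sform0l sqrtC0 ltW.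
Qed.

Lemma cauchy_pairing e h : cauchy_seq e -> cauchy_seq h ->
  is_cauchy (@Num.norm _ C) (fun n => B (e n) (h n)).
Proof.
move=> ce ch eps eps0.
have [M [M0 eM]] := cauchy_bounded ce; have [L [L0 hL]] := cauchy_bounded ch.
have e1 : 0 < eps / 2 / L by rewrite !divr_gt0.
have e2 : 0 < eps / 2 / M by rewrite !divr_gt0.
have [N1 h1] := ce _ e1; have [N2 h2] := ch _ e2.
exists (maxn N1 N2) => i j; rewrite !geq_max => /andP[i1 i2] /andP[j1 j2].
rewrite (le_trans (sform_diff _ _ _ _)) // [eps]splitr lerD //.
  rewrite (le_trans (ler_wpM2l (snorm_ge0 _) (hL _))) //.
  by rewrite -ler_pdivlMr // h1.
rewrite (le_trans (ler_wpM2r (snorm_ge0 _) (eM _))) // mulrC.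
by rewrite -ler_pdivlMr // h2.
Qed.

(** [B (e n) (e n)] is close to [B (e m) (e n)] for all large [m], and the latter
    tends to [0] as [m] grows with [n] fixed. *)
Lemma weakly_null_cauchy e : cauchy_seq e ->
    (forall x, (fun n => B (e n) x) @ \oo --> (0 : C^o)) ->
  forall eps : C, 0 < eps -> exists N, forall n, (N <= n)%N -> snorm (e n) <= eps.
Proof.
move=> ce e0 eps eps0; have [M [M0 eM]] := cauchy_bounded ce.
have eps2 : 0 < eps ^+ 2 / 2 / M by rewrite !divr_gt0 ?exprn_gt0.
have [N hN] := ce _ eps2; exists N => n Nn.
rewrite -(@ler_pXn2r _ 2) ?nnegrE ?snorm_ge0 ?(ltW eps0) // snorm_sqr.
have eps20 : 0 < eps ^+ 2 / 2 by rewrite divr_gt0 ?exprn_gt0.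
have /cvgn_scalarP/(_ _ eps20)[N' hN'] := e0 (e n).
have -> : B (e n) (e n) = `|B (e n) (e n)| by rewrite ger0_norm ?sform_ge0.
pose m := maxn N N'; rewrite -[B _ _](subrK (B (e m) (e n))) -sformBl.
rewrite (le_trans (ler_normD _ _)) // [leRHS]splitr lerD //.
  rewrite (le_trans (sform_cauchy_schwarz _ _)) //.
  rewrite (le_trans (ler_wpM2l (snorm_ge0 _) (eM _))) //.
  by rewrite -ler_pdivlMr // hN // leq_maxl.
by have := hN' m (leq_maxr _ _); rewrite sub0r normrN.
Qed.

End SemiInnerProduct.

(** * Completion of a semi-inner product space *)

Section Completion.
Variable R : realType.
Local Notation C := R[i].
Variables (E : lmodType C) (B : semi_inner E).

(** An element of the completion of [E] is encoded as the linear functional of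
    inner products with the vectors of [E], instead of a class of Cauchy
    sequences. *)
Definition represents (e : nat -> E) (f : E -> C^o) :=
  is_cauchy (snorm B) e /\ forall x, (fun n => B (e n) x) @ \oo --> f x.

Definition representable : {pred E -> C^o} :=
  fun f => `[< exists e, represents e f >].

Lemma represents_linear a e h f g : represents e f -> represents h g ->
  represents (fun n => a *: e n + h n) (a *: f + g).
Proof.
move=> [ce ef] [ch hg]; split=> [|x]; first exact: cauchy_linear.
rewrite (_ : (fun n => _) = (fun n => a * B (e n) x + B (h n) x)).
  by apply: cvgn_scalarD; [apply: cvgn_scalarM; exact: ef|exact: hg].
by apply/funext => n; rewrite sform_linear.
Qed.

Lemma represents_cst x : represents (fun=> x) (B x).
Proof.
by split=> [|y]; [exact: cauchy_cst|exact: (@cvg_cst C^o)].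
Qed.

Lemma represents0 : represents (fun=> 0) 0.
Proof.
split=> [|x]; first exact: cauchy_cst.
rewrite (_ : (fun n => _) = fun=> 0); first exact: (@cvg_cst C^o).
by apply/funext => n; rewrite sform0l.
Qed.

Lemma represents_representable e f : represents e f -> f \in representable.
Proof. by move=> ef; apply/asboolP; exists e. Qed.

Lemma representable_submod_closed : submod_closed representable.
Proof.
split; first by apply/asboolP; exists (fun=> 0); exact: represents0.
move=> a f g /asboolP[e ef] /asboolP[h hg]; apply/asboolP.
by exists (fun n => a *: e n + h n); exact: represents_linear.
Qed.

HB.instance Definition _ :=
  GRing.isSubmodClosed.Build C (E -> C^o) representable representable_submod_closed.

Record completion := Completion {
  functional :> E -> C^o ;
  functionalP : functional \in representable }.

HB.instance Definition _ := [isSub for functional].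
HB.instance Definition _ := [Choice of completion by <:].
HB.instance Definition _ := [SubChoice_isSubLmodule of completion by <:].

Implicit Types f g : completion.

Lemma completion_ext f g : functional f =1 functional g -> f = g.
Proof.
move: f g => [f pf] [g pg] /= /funext fg.
by move: pg; rewrite -fg => pg; congr Completion; exact: bool_irrelevance.
Qed.

Lemma functional_linearE a f g :
  functional (a *: f + g) = a *: functional f + functional g.
Proof. by []. Qed.

Lemma functional_linear a f g x :
  functional (a *: f + g) x = a * functional f x + functional g x.
Proof. by []. Qed.

Fact completion_represented f : exists e, represents e f.
Proof. by have /asboolP := functionalP f. Qed.

Definition representative f : nat -> E := sval (cid (completion_represented f)).

Lemma representativeP f : represents (representative f) f.
Proof. by rewrite /representative; case: cid. Qed.

(** Makes inner products independent of the representing sequences: sequences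
    with the same functional differ by a weakly null Cauchy sequence. *)
Lemma represents_same e e' f : represents e f -> represents e' f ->
  forall eps : C, 0 < eps ->
  exists N, forall n, (N <= n)%N -> snorm B (e n - e' n) <= eps.
Proof.
move=> ef e'f eps eps0.
have [c0 n0] := represents_linear (- 1) e'f ef.
have [|N hN] := weakly_null_cauchy c0 _ eps0.
  by move=> x; have := n0 x; rewrite scaleN1r addNr.
by exists N => n /hN; rewrite scaleN1r addrC.
Qed.

Definition completion_form f g : C :=
  lim ((fun n => B (representative f n) (representative g n) : C^o) @ \oo).

Lemma completion_form_cvg e h f g : represents e f -> represents h g ->
  (fun n => B (e n) (h n)) @ \oo --> (completion_form f g : C^o).
Proof.
move=> ef hg; have [/cauchy_bounded[M [M0 _]] _] := ef.
have rf := representativeP f; have rg := representativeP g.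
have [l cl] := complex_is_cauchy_cvgn (cauchy_pairing rf.1 rg.1).
have -> : completion_form f g = l by exact: (cvg_lim (@norm_hausdorff _ C^o) cl).
apply/cvgn_scalarP => eps eps0.
have [L [L0 hL]] := cauchy_bounded hg.1.
have [P [P0 fP]] := cauchy_bounded rf.1.
have eps3 : 0 < eps / 3 by rewrite divr_gt0.
have /cvgn_scalarP/(_ _ eps3)[N1 h1] := cl.
have [N2 h2] := represents_same rf ef (divr_gt0 eps3 L0).
have [N3 h3] := represents_same rg hg (divr_gt0 eps3 P0).
exists (maxn N1 (maxn N2 N3)) => n; rewrite !geq_max => /and3P[n1 n2 n3].
have -> : eps = eps / 3 + (eps / 3 + eps / 3) by field.
rewrite (le_trans (ler_distD (B (representative f n) (representative g n)) _ _)) // lerD ?h1 //.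
have -> : B (representative f n) (representative g n) - B (e n) (h n) =
    B (representative f n - e n) (h n) +
    B (representative f n) (representative g n - h n).
  by rewrite !(sformBl, sformBr); ring.
rewrite (le_trans (ler_normD _ _)) // lerD //.
  rewrite (le_trans (sform_cauchy_schwarz _ _ _)) //.
  rewrite (le_trans (ler_wpM2l (snorm_ge0 _ _) (hL _))) //.
  by rewrite -ler_pdivlMr // h2.
rewrite (le_trans (sform_cauchy_schwarz _ _ _)) //.
rewrite (le_trans (ler_wpM2r (snorm_ge0 _ _) (fP _))) // mulrC.
by rewrite -ler_pdivlMr // h3.
Qed.

Lemma completion_form_linear a f g h :
  completion_form (a *: f + g) h =
  a * completion_form f h + completion_form g h.
Proof.
have [[rf rg] rh] := (representativeP f, representativeP g, representativeP h).
have rfg : represents (fun n => a *: representative f n + representative g n)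
    (a *: f + g) by exact: represents_linear rf rg.
have c1 := completion_form_cvg rfg rh.
have c2 := cvgn_scalarD (@cvgn_scalarM _ a _ _ (completion_form_cvg rf rh))
  (completion_form_cvg rg rh).
move: c1; under eq_fun do rewrite sform_linear.
by move=> c1; exact: (@cvgn_unique _ C^o _ _ _ c1 c2).
Qed.

Lemma completion_form_conj f g :
  completion_form g f = (completion_form f g)^*%R.
Proof.
have [rf rg] := (representativeP f, representativeP g).
have c1 := completion_form_cvg rg rf.
have c2 := cvgn_conj (completion_form_cvg rf rg).
move: c1; under eq_fun do rewrite [B _ _]sform_conj.
by move=> c1; exact: (@cvgn_unique _ C^o _ _ _ c1 c2).
Qed.

Lemma completion_form_ge0 f : 0 <= completion_form f f.
Proof.
have rf := representativeP f.
apply: (@cvgn_complex_ge0 _ 0) (completion_form_cvg rf rf) => n _.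
exact: sform_ge0.
Qed.

Definition completion_inner : semi_inner completion :=
  SemiInner completion_form_linear completion_form_conj completion_form_ge0.

Definition embed (x : E) : completion :=
  Completion (represents_representable (represents_cst x)).

Lemma embed_is_linear : linear embed.
Proof.
by move=> a x y; apply: completion_ext => z; rewrite functional_linear /= sform_linear.
Qed.
HB.instance Definition _ := GRing.isLinear.Build C E completion _ embed
  embed_is_linear.

Lemma completion_form_embed f x : completion_form f (embed x) = f x.
Proof.
have [_ fx] := representativeP f.
have := completion_form_cvg (representativeP f) (represents_cst x : represents _ (embed x)).
by move=> c; exact: (@cvgn_unique _ C^o _ _ _ c (fx x)).
Qed.

Lemma completion_form_embed2 x y : completion_form (embed x) (embed y) = B x y.
Proof. exact: completion_form_embed. Qed.

Lemma represents_approx e f : represents e f -> forall eps : C, 0 < eps ->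
  exists N, forall n, (N <= n)%N ->
    snorm completion_inner (f - embed (e n)) <= eps.
Proof.
move=> ef eps eps0; have [N hN] := ef.1 _ eps0; exists N => n Nn.
rewrite -(@ler_pXn2r _ 2) ?nnegrE ?snorm_ge0 ?(ltW eps0) // snorm_sqr /=.
have ed : represents (fun m => - 1 *: e n + e m) (f - embed (e n)).
  rewrite -[- embed (e n)]scaleN1r [f + _]addrC.
  have en : represents (fun=> e n) (embed (e n)) by exact: represents_cst.
  by have := represents_linear (- 1) en ef; rewrite -functional_linearE.
apply: (@cvgn_complex_le _ N) (completion_form_cvg ed ed) => m Nm.
rewrite -snorm_sqr ler_pXn2r ?nnegrE ?snorm_ge0 ?(ltW eps0) //.
by rewrite scaleN1r addrC hN.
Qed.

Lemma snorm_embed x : snorm completion_inner (embed x) = snorm B x.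
Proof. by rewrite /snorm /= completion_form_embed2. Qed.

(** The value of [f] at [x] is the inner product of [f] with [embed x], so a null
    vector is the zero functional by Cauchy-Schwarz. *)
Lemma snorm_completion_eq0 f : snorm completion_inner f = 0 -> f = 0.
Proof.
move=> f0; apply: completion_ext => x.
have := sform_cauchy_schwarz completion_inner f (embed x).
by rewrite f0 mul0r /= completion_form_embed normr_le0 => /eqP.
Qed.

HB.instance Definition _ := Lmodule_isNormed.Build C completion
  (ler_snormD completion_inner) (snormZ completion_inner) snorm_completion_eq0.

Lemma completion_normE f : `|f| = snorm completion_inner f.
Proof. by []. Qed.

(** Approximating the terms of a Cauchy sequence of functionals by vectors of
    [E] yields a Cauchy sequence of [E], whose functional is the limit. *)
Lemma completion_sequentially_complete (u : nat -> completion) :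
  is_cauchy (@Num.norm _ completion) u -> exists f : completion, u @ \oo --> f.
Proof.
move=> cu; have /choice[x hx] : forall n, exists x, `|u n - embed x| <= n.+1%:R^-1.
  move=> n; have n0 : 0 < n.+1%:R^-1 :> C by rewrite invr_gt0.
  have [N hN] := represents_approx (representativeP (u n)) n0.
  by exists (representative (u n) N); exact: hN.
have cx : is_cauchy (snorm B) x.
  move=> eps eps0; have e3 : 0 < eps / 3 by rewrite divr_gt0.
  have [N1 h1] := cu _ e3; have [N2 h2] := complex_archimedean e3.
  exists (maxn N1 N2) => i j; rewrite !geq_max => /andP[i1 i2] /andP[j1 j2].
  rewrite -snorm_embed raddfB -completion_normE.
  have -> : eps = eps / 3 + (eps / 3 + eps / 3) by field.
  rewrite (le_trans (ler_distD (u i) _ _)) //.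
  apply: lerD; first by rewrite distrC; exact: le_trans (hx _) (h2 _ i2).
  rewrite (le_trans (ler_distD (u j) _ _)) //.
  apply: lerD; first exact: h1.
  exact: le_trans (hx _) (h2 _ j2).
have /choice[g hg] : forall y, exists l : C, (fun n => B (x n) y) @ \oo --> (l : C^o).
  move=> y; have /complex_is_cauchy_cvgn[l xl] := cauchy_pairing cx (cauchy_cst B y).
  by exists l.
have xg : represents x g by [].
pose f := Completion (represents_representable xg).
exists f; apply/cvgn_complexP => eps eps0.
have [N1 h1] := represents_approx (xg : represents x f) (divr_gt0 eps0 (ltr0Sn _ 1)).
have [N2 h2] := complex_archimedean (divr_gt0 eps0 (ltr0Sn _ 1)).
exists (maxn N1 N2) => n; rewrite geq_max => /andP[n1 n2].
rewrite (le_trans (ler_distD (embed (x n)) _ _)) //.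
rewrite [leRHS]splitr; apply: lerD; first exact: h1.
by rewrite distrC; exact: le_trans (hx _) (h2 _ n2).
Qed.

HB.instance Definition _ := Uniform_isComplete.Build completion
  (sequentially_complete completion_sequentially_complete).

Lemma completion_form_bilinear : bilinear_for
  (GRing.Scale.Law.clone _ _ *%R _)
  (GRing.Scale.Law.clone _ _ (Num.conj \; *%R) _) completion_form.
Proof.
split=> [h|h] a f g; first exact: (sform_linear completion_inner).
by rewrite -[completion_form]/(sform completion_inner) !sform_rules.
Qed.

HB.instance Definition _ := bilinear_isBilinear.Build C completion completion C
  (GRing.Scale.Law.clone _ _ *%R _) (GRing.Scale.Law.clone _ _ (Num.conj \; *%R) _)
  completion_form completion_form_bilinear.

Lemma completion_form_hermitian f g :
  completion_form f g = (- 1) ^+ false * (completion_form g f)^*%R.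
Proof. by rewrite expr0 mul1r -completion_form_conj. Qed.

HB.instance Definition _ := isHermitianSesquilinear.Build C completion
  false Num.conj completion_form completion_form_hermitian.

Lemma completion_form_gt0 f : f != 0 -> 0 < completion_form f f.
Proof.
move=> f0; rewrite lt_def completion_form_ge0 andbT.
apply: contra f0 => /eqP f0; apply/eqP/snorm_completion_eq0.
by rewrite /snorm /= f0 sqrtC0.
Qed.

HB.instance Definition _ := isDotProduct.Build C completion
  completion_form completion_form_gt0.

Lemma completion_inner_norm f : completion_form f f = `|f| ^+ 2.
Proof. by rewrite completion_normE snorm_sqr. Qed.

Definition completion_hilbert : hilbertSpace R :=
  @HilbertSpace R completion completion_form completion_inner_norm.

End Completion.

(** * Extension of contractions to the completion *)

Section Extension.
Variable R : realType.
Local Notation C := R[i].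
Variables (E : lmodType C) (B : semi_inner E) (A A' : {linear E -> E}).
Hypothesis adjAA' : forall x y, B (A x) y = B x (A' y).
Hypothesis contrA : forall x, B (A x) (A x) <= B x x.

Lemma snorm_contraction x : snorm B (A x) <= snorm B x.
Proof. by rewrite ler_sqrtC ?nnegrE ?sform_ge0. Qed.

Lemma represents_contraction e (f : E -> C^o) : represents B e f ->
  represents B (A \o e) (f \o A').
Proof.
move=> [ce ef]; split=> [eps eps0|x].
  have [N hN] := ce _ eps0; exists N => i j iN jN /=.
  by rewrite -raddfB (le_trans (snorm_contraction _)) // hN.
by under eq_fun do rewrite /= adjAA'; exact: ef.
Qed.

(** In terms of functionals, extending an operator to the completion is
    composing with its adjoint. *)
Definition extension (f : completion B) : completion B :=
  Completion (represents_representable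
    (represents_contraction (representativeP f))).

Lemma extensionE f x : extension f x = f (A' x).
Proof. by []. Qed.

Lemma extension_is_linear : linear extension.
Proof.
move=> a f g; apply: completion_ext => x.
by rewrite extensionE !functional_linear !extensionE.
Qed.

HB.instance Definition _ := GRing.isLinear.Build C (completion B)
  (completion B) _ extension extension_is_linear.

Lemma extension_embed x : extension (embed B x) = embed B (A x).
Proof. by apply: completion_ext => y; rewrite extensionE /= adjAA'. Qed.

Lemma norm_extension f : `|extension f| <= `|f|.
Proof.
suff : completion_form (extension f) (extension f) <= completion_form f f.
  by rewrite !completion_inner_norm; rewrite ler_pXn2r ?nnegrE.
have rf := representativeP f; have rAf := represents_contraction rf.
have c1 := completion_form_cvg rf rf.
have c2 := @completion_form_cvg _ _ _ _ _ (extension f) (extension f) rAf rAf.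
have c3 := cvgn_scalarD c1 (@cvgn_scalarM _ (- 1) _ _ c2).
rewrite -subr_ge0 -[- _]mulN1r; apply: (@cvgn_complex_ge0 _ 0) c3 => n _.
by rewrite mulN1r subr_ge0 /= contrA.
Qed.

End Extension.

Section ExtensionAdjoint.
Variable R : realType.
Local Notation C := R[i].
Variables (E : lmodType C) (B : semi_inner E) (A A' : {linear E -> E}).
Hypothesis adjAA' : forall x y, B (A x) y = B x (A' y).
Hypothesis contrA : forall x, B (A x) (A x) <= B x x.
Hypothesis contrA' : forall x, B (A' x) (A' x) <= B x x.

Fact sform_adjointC x y : B (A' x) y = B x (A y).
Proof. by rewrite sform_conj -adjAA' -sform_conj. Qed.

Lemma extension_adjoint f g :
  completion_form (extension adjAA' contrA f) g =
  completion_form f (extension sform_adjointC contrA' g).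
Proof.
have rf := representativeP f; have rg := representativeP g.
have c1 := @completion_form_cvg _ _ _ _ _ (extension adjAA' contrA f) g
  (represents_contraction adjAA' contrA rf) rg.
have c2 := @completion_form_cvg _ _ _ _ _ f (extension sform_adjointC contrA' g)
  rf (represents_contraction sform_adjointC contrA' rg).
move: c1; under eq_fun do rewrite /= adjAA'.
by move=> c1; exact: (@cvgn_unique _ C^o _ _ _ c1 c2).
Qed.

Lemma extension_commute f : (forall x, A (A' x) = A' (A x)) ->
  extension adjAA' contrA (extension sform_adjointC contrA' f) =
  extension sform_adjointC contrA' (extension adjAA' contrA f).
Proof. by move=> AA'; apply: completion_ext => x; rewrite !extensionE AA'. Qed.

End ExtensionAdjoint.

(** * Polynomials in a complex variable and its conjugate *)

Section Bivariate.
Variable R : realType.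
Local Notation C := R[i].
Local Open Scope complex_scope.

(** Polynomials in [z] and its conjugate, the latter being the inner variable.
    The alias is there to carry scalar multiplication by [R[i]], whereas
    [{poly {poly C}}] is a module over [{poly C}]. *)
Definition bipoly : Type := {poly {poly C}}.

HB.instance Definition _ := GRing.ComNzRing.on bipoly.

Definition bipoly_scale (a : C) (p : bipoly) : bipoly :=
  (a%:P%R : {poly C}) *: (p : {poly {poly C}}).

Fact bipoly_scaleA a b p :
  bipoly_scale a (bipoly_scale b p) = bipoly_scale (a * b) p.
Proof. by rewrite /bipoly_scale scalerA polyCM. Qed.

Fact bipoly_scale1 : left_id 1 bipoly_scale.
Proof. by move=> p; rewrite /bipoly_scale scale1r. Qed.

Fact bipoly_scaleDr : right_distributive bipoly_scale +%R.
Proof. by move=> a p q; rewrite /bipoly_scale scalerDr. Qed.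

Fact bipoly_scaleDl p : {morph bipoly_scale^~ p : a b / a + b}.
Proof. by move=> a b; rewrite /bipoly_scale polyCD scalerDl. Qed.

HB.instance Definition _ := GRing.Zmodule_isLmodule.Build C bipoly
  bipoly_scaleA bipoly_scale1 bipoly_scaleDr bipoly_scaleDl.

Definition bicoef (p : bipoly) (i j : nat) : C := (p : {poly {poly C}})`_i`_j.

Lemma bipolyP (p q : bipoly) : (forall i j, bicoef p i j = bicoef q i j) -> p = q.
Proof. by move=> pq; apply/polyP => i; apply/polyP => j; exact: pq. Qed.

Lemma bicoefD p q i j : bicoef (p + q) i j = bicoef p i j + bicoef q i j.
Proof. by rewrite /bicoef !coefD. Qed.

Lemma bicoefZ a p i j : bicoef (a *: p) i j = a * bicoef p i j.
Proof. by rewrite /bicoef coefZ coefCM. Qed.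

(** The polynomial that takes the conjugate values: it conjugates coefficients
    and exchanges [z] with its conjugate. *)
Definition star (p : bipoly) : bipoly :=
  map_poly (map_poly (@Num.conj C)) (swapXY p).

Lemma bicoef_star p i j : bicoef (star p) i j = (bicoef p j i)^*%R.
Proof. by rewrite /bicoef /star !coef_map coef_swapXY. Qed.

Lemma starM p q : star (p * q) = star p * star q.
Proof. by rewrite /star !rmorphM. Qed.

Lemma starK : involutive star.
Proof. by move=> p; apply: bipolyP => i j; rewrite !bicoef_star conjCK. Qed.

Lemma starD p q : star (p + q) = star p + star q.
Proof. by apply: bipolyP => i j; rewrite bicoefD !bicoef_star bicoefD rmorphD. Qed.

Definition coordz : bipoly := 'X.
Definition coordzb : bipoly := 'X%:P.

Lemma star_coordz : star coordz = coordzb.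
Proof. by rewrite /star swapXY_X map_polyC /= map_polyX. Qed.

Lemma star_coordzb : star coordzb = coordz.
Proof. by rewrite -star_coordz starK. Qed.

(** Averaging over the rotations of [z] keeps the monomials in which [z] and its
    conjugate have equal exponents; the result is a polynomial in [|z|^2]. *)
Definition diagpart (u : bipoly) : {poly C} :=
  \poly_(i < size (u : {poly {poly C}})) bicoef u i i.

Lemma coef_diagpart u i : (diagpart u)`_i = bicoef u i i.
Proof.
rewrite coef_poly; case: ltnP => // ui.
by rewrite /bicoef [X in polyseq X]nth_default // coef0.
Qed.

Lemma diagpart_linear a u v :
  diagpart (a *: u + v) = a *: diagpart u + diagpart v.
Proof.
by apply/polyP => i; rewrite coefD coefZ !coef_diagpart bicoefD bicoefZ.
Qed.

Lemma diagpart_star u : diagpart (star u) = map_poly (@Num.conj C) (diagpart u).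
Proof. by apply/polyP => i; rewrite coef_map !coef_diagpart bicoef_star. Qed.

Lemma diagpart_coords u : diagpart (coordz * coordzb * u) = 'X * diagpart u.
Proof.
apply/polyP => i; rewrite coefXM !coef_diagpart /bicoef -mulrA coefXM.
by case: i => [|i] /=; rewrite ?coef0 // mul_polyC coefZ coefXM.
Qed.

Lemma diagpart_monomial m n :
  diagpart (coordz ^+ m * coordzb ^+ n) = if m == n then 'X^m else 0.
Proof.
apply/polyP => i; rewrite coef_diagpart /bicoef -rmorphXn /= mulrC mul_polyC.
rewrite coefZ coefXn; have [->|im] := eqVneq i m.
  by rewrite mulr1 coefXn; case: eqVneq => [->|]; rewrite ?coefXn ?eqxx ?coef0.
by rewrite mulr0 coef0; case: eqVneq; rewrite ?coef0 // coefXn (negPf im).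
Qed.

Definition monomial (a b : nat) : bipoly := coordz ^+ a * coordzb ^+ b.

Lemma bicoef_monomial a b i j :
  bicoef (monomial a b) i j = ((i == a) && (j == b))%:R.
Proof.
rewrite /bicoef /monomial -rmorphXn /= mulrC mul_polyC coefZ coefXn.
by case: (i == a); rewrite ?mulr1 ?mulr0 ?coefXn ?coef0.
Qed.

Lemma bipoly_expand (p : bipoly) : exists D,
  p = \sum_(s : 'I_D * 'I_D) bicoef p s.1 s.2 *: monomial s.1 s.2.
Proof.
have bicoef_sum I (r : seq I) (F : I -> bipoly) i j :
    bicoef (\sum_(k <- r) F k) i j = \sum_(k <- r) bicoef (F k) i j.
  by rewrite /bicoef !coef_sum.
pose D := maxn (size (p : {poly {poly C}})) (sizeY p); exists D.
apply: bipolyP => i j; rewrite bicoef_sum.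
have [iD|Di] := ltnP i D; last first.
  rewrite big1 => [|[[a aD] [b bD]] _ /=].
    by rewrite /bicoef [X in polyseq X]nth_default ?coef0 // (leq_trans (leq_maxl _ _) Di).
  rewrite bicoefZ bicoef_monomial; case: eqVneq => [ia|]; last by rewrite mulr0.
  by move: aD; rewrite -ia ltnNge Di.
have [jD|Dj] := ltnP j D; last first.
  rewrite big1 => [|[[a aD] [b bD]] _ /=].
    rewrite /bicoef nth_default // (leq_trans _ (leq_trans (leq_maxr _ _) Dj)) //.
    exact: max_size_coefXY.
  rewrite bicoefZ bicoef_monomial andbC; case: eqVneq => [jb|]; last by rewrite mulr0.
  by move: bD; rewrite -jb ltnNge Dj.
rewrite (bigD1 (Ordinal iD, Ordinal jD)) //= big1 => [|[a b] ab].
  by rewrite addr0 bicoefZ bicoef_monomial !eqxx mulr1.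
rewrite bicoefZ bicoef_monomial; case: andP => [[/eqP ia /eqP jb]|]; last by rewrite mulr0.
by case/eqP: ab; congr (_, _); apply: val_inj.
Qed.

Lemma star_monomial a b : star (monomial a b) = monomial b a.
Proof.
by apply: bipolyP => i j; rewrite bicoef_star !bicoef_monomial andbC conjC_nat.
Qed.

Lemma monomialM a b c d :
  monomial a b * monomial c d = monomial (a + c) (b + d).
Proof. by rewrite /monomial mulrACA -!exprD. Qed.

End Bivariate.

(** * The inner product attached to a moment sequence *)

Section MomentForm.
Variable R : realType.
Local Notation C := R[i].
Local Open Scope complex_scope.
Implicit Types (p q u : bipoly R) (g : nat -> R).

Lemma conj_real_complex (x : R) : (x%:C)^*%R = x%:C.
Proof.
by apply/CrealP; rewrite realE !lecR le_total.
Qed.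

Lemma starZ (a : C) p : star (a *: p) = a^*%R *: star p.
Proof. by apply: bipolyP => i j; rewrite bicoefZ !bicoef_star bicoefZ rmorphM. Qed.

Lemma bipoly_scaleM (a b : C) p q : (a *: p) * (b *: q) = (a * b) *: (p * q).
Proof.
rewrite /GRing.scale /= /bipoly_scale polyCM.
by rewrite -scalerAl -scalerAr scalerA.
Qed.

Lemma diagpartD u v : diagpart (u + v) = diagpart u + diagpart v.
Proof. by rewrite -[u in LHS]scale1r diagpart_linear scale1r. Qed.

Lemma diagpart0 : diagpart (0 : bipoly R) = 0.
Proof. by apply: (addrI (diagpart 0)); rewrite -diagpartD !addr0. Qed.

Lemma diagpartZ (a : C) u : diagpart (a *: u) = a *: diagpart u.
Proof. by rewrite -[a *: u]addr0 diagpart_linear diagpart0 addr0. Qed.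

Lemma diagpart_sum I (r : seq I) (F : I -> bipoly R) :
  diagpart (\sum_(i <- r) F i) = \sum_(i <- r) diagpart (F i).
Proof. exact: (big_morph _ diagpartD diagpart0). Qed.

Lemma star_sum I (r : seq I) (F : I -> bipoly R) :
  star (\sum_(i <- r) F i) = \sum_(i <- r) star (F i).
Proof.
apply: (big_morph _ (@starD R)).
by apply: bipolyP => i j; rewrite bicoef_star /bicoef !coef0 conjC0.
Qed.

(** Parseval's identity on the circle of radius [r = sqrt x]: with
    [p = sum c_(a,b) z^a zbar^b], the left-hand side is the sum over the
    frequencies [m = a - b] of the squared moduli of
    [sum_(a - b = m) c_(a,b) r^(a + b)]. *)
Lemma diagpart_square_ge0 p (x : R) :
  0 <= x -> 0 <= (diagpart (p * star p)).[x%:C].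
Proof.
move=> x0; have [D pE] := bipoly_expand p.
pose c (s : 'I_D * 'I_D) : C := bicoef p s.1 s.2.
pose r : C := (Num.sqrt x)%:C.
have r2 : r ^+ 2 = x%:C by rewrite /r -rmorphXn /= sqr_sqrtr.
(* Frequencies are shifted by [D] in order to be natural numbers. *)
pose v (s : 'I_D * 'I_D) (m : nat) : C :=
  if (s.1 + D == s.2 + m)%N then r ^+ (s.1 + s.2) else 0.
have vr s m : (v s m)^*%R = v s m.
  rewrite /v; case: ifP => _; last by rewrite conjC0.
  by rewrite rmorphXn /= conj_real_complex.
have -> : (diagpart (p * star p)).[x%:C] =
    \sum_(m < D + D) (\sum_s c s * v s m) * (\sum_s c s * v s m)^*%R.
  rewrite {1 2}pE star_sum mulr_suml diagpart_sum horner_sum.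
  under [RHS]eq_bigr => m _ do rewrite mulr_suml.
  rewrite exchange_big; apply: eq_bigr => s _.
  rewrite mulr_sumr diagpart_sum horner_sum.
  under [RHS]eq_bigr => m _ do rewrite rmorph_sum /= mulr_sumr.
  rewrite exchange_big; apply: eq_bigr => t _.
  rewrite starZ star_monomial bipoly_scaleM monomialM diagpartZ hornerZ.
  under [RHS]eq_bigr => m _ do rewrite rmorphM /= vr mulrACA.
  rewrite -mulr_sumr; congr (_ * _).
  have m0D : (s.1 + D - s.2 < D + D)%N.
    by rewrite (leq_ltn_trans (leq_subr _ _)) // ltn_add2r.
  have s2D : (s.2 <= s.1 + D)%N by rewrite ltnW // ltn_addl.
  rewrite (bigD1 (Ordinal m0D)) //= big1 => [|m mm0]; last first.
    rewrite /v; case: ifP => [/eqP sm|_]; last by rewrite mul0r.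
    case/eqP: mm0; apply: val_inj => /=.
    by rewrite sm addnC addnK.
  rewrite addr0 /v subnKC // eqxx.
  have -> : (t.1 + D == t.2 + (s.1 + D - s.2))%N = (s.1 + t.2 == s.2 + t.1)%N.
    rewrite addnBA // -(eqn_add2r s.2) subnK; last first.
      by rewrite (leq_trans s2D) // leq_addl.
    rewrite addnAC [(t.2 + _)%N]addnA eqn_add2r eq_sym.
    by rewrite [(t.2 + _)%N]addnC [(t.1 + _)%N]addnC.
  rewrite diagpart_monomial; case: eqVneq => [st|_]; last by rewrite horner0 mulr0.
  rewrite hornerXn -exprD.
  have -> : (s.1 + s.2 + (t.1 + t.2) = 2 * (s.1 + t.2))%N.
    by rewrite mul2n -addnn {2}st [(t.1 + _)%N]addnC addnACA.
  by rewrite exprM r2.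
by apply: sumr_ge0 => m _; exact: mul_conjC_ge0.
Qed.

Definition moment g (q : {poly C}) : C := \sum_(i < size q) (g i)%:C * q`_i.

Lemma momentE g n (q : {poly C}) : (size q <= n)%N ->
  moment g q = \sum_(i < n) (g i)%:C * q`_i.
Proof.
move=> qn; rewrite /moment (big_ord_widen n (fun i => (g i)%:C * q`_i)) //.
rewrite [LHS]big_mkcond. apply: eq_bigr => i _ /=.
by case: ltnP => // qi; rewrite nth_default // mulr0.
Qed.

Lemma moment_linear g (a : C) (q r : {poly C}) :
  moment g (a *: q + r) = a * moment g q + moment g r.
Proof.
pose n := maxn (size (a *: q + r)) (maxn (size q) (size r)).
rewrite !(@momentE g n) ?leq_max ?leqnn ?orbT //.
rewrite mulr_sumr -big_split; apply: eq_bigr => i _ /=.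
by rewrite coefD coefZ; ring.
Qed.

Lemma moment_conj g (q : {poly C}) :
  moment g (map_poly (@Num.conj C) q) = (moment g q)^*%R.
Proof.
rewrite /moment size_map_poly rmorph_sum; apply: eq_bigr => i _.
by rewrite coef_map rmorphM /= conj_real_complex.
Qed.

Lemma momentXn g m : moment g 'X^m = (g m)%:C.
Proof.
rewrite /moment size_polyXn big_ord_recr /= coefXn eqxx mulr1 big1 ?add0r //.
by move=> [i im] _ /=; rewrite coefXn ltn_eqF // mulr0.
Qed.

Variables (g : nat -> R) (cmg : completely_monotone g).

(** If [g k] is the integral of [x^k] for a measure on [[0, 1]], this is the inner
    product of L^2 of the rotation-invariant measure on the closed disc in which
    [|z|^2] has that distribution. *)
Definition moment_form p q : C := moment g (diagpart (p * star q)).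

Lemma moment_form_linear a p q u :
  moment_form (a *: p + q) u = a * moment_form p u + moment_form q u.
Proof.
rewrite /moment_form -moment_linear -diagpart_linear; congr (moment g (diagpart _)).
by rewrite mulrDl -[star u]scale1r bipoly_scaleM mulr1 !scale1r.
Qed.

Lemma moment_form_conj p q : moment_form q p = (moment_form p q)^*%R.
Proof.
by rewrite /moment_form -moment_conj -diagpart_star starM starK mulrC.
Qed.

Lemma moment_form_ge0 p : 0 <= moment_form p p.
Proof.
apply: completely_monotone_functional_ge0 => // x /andP[x0 _].
exact: diagpart_square_ge0.
Qed.

Definition moment_inner : semi_inner (bipoly R) :=
  SemiInner moment_form_linear moment_form_conj moment_form_ge0.

Definition mulcoord (c p : bipoly R) : bipoly R := c * p.

Lemma mulcoord_is_linear c : linear (mulcoord c).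
Proof.
move=> a p q; rewrite /mulcoord mulrDr; congr (_ + _).
by rewrite -[c in LHS]scale1r bipoly_scaleM mul1r.
Qed.

HB.instance Definition _ c := GRing.isLinear.Build C (bipoly R) (bipoly R) _
  (mulcoord c) (mulcoord_is_linear c).

Lemma moment_form_adjoint p q : moment_inner (mulcoord (coordz R) p) q =
  moment_inner p (mulcoord (coordzb R) q).
Proof.
rewrite /= /moment_form /mulcoord starM star_coordzb.
by rewrite mulrA [coordz R * p]mulrC.
Qed.

(** The difference of the two sides is the functional of [g] at the product of
    [1 - x] with a polynomial that is nonnegative on [[0, 1]]. *)
Lemma moment_form_coord p :
  moment_form (mulcoord (coordz R) p) (mulcoord (coordz R) p) <= moment_form p p.
Proof.
rewrite -subr_ge0 /moment_form /mulcoord starM star_coordz mulrACA diagpart_coords.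
set q := diagpart _.
have -> : moment g q - moment g ('X * q) = moment g ((1 - 'X) * q).
  by rewrite mulrBl mul1r [q - _]addrC -[- ('X * q)]scaleN1r moment_linear mulN1r addrC.
apply: completely_monotone_functional_ge0 => // x /andP[x0 x1].
rewrite hornerM !hornerE mulr_ge0 ?diagpart_square_ge0 //.
by rewrite subr_ge0 lecR.
Qed.

Lemma moment_form_coordb p :
  moment_form (mulcoord (coordzb R) p) (mulcoord (coordzb R) p) =
  moment_form (mulcoord (coordz R) p) (mulcoord (coordz R) p).
Proof.
rewrite /moment_form /mulcoord !starM star_coordz star_coordzb.
congr (moment g (diagpart _)).
by rewrite [LHS]mulrACA [RHS]mulrACA [coordzb R * coordz R]mulrC.
Qed.

Lemma moment_form_powers m n :
  moment_form (coordz R ^+ m) (coordz R ^+ n) = if m == n then (g m)%:C else 0.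
Proof.
rewrite /moment_form.
have -> : star (coordz R ^+ n) = coordzb R ^+ n.
  elim: n => [|n IHn]; last by rewrite !exprS starM star_coordz IHn.
  by have := star_monomial R 0 0; rewrite /monomial !expr0 mul1r.
rewrite diagpart_monomial; case: eqVneq => _; first exact: momentXn.
by rewrite /moment size_poly0 big_ord0.
Qed.

End MomentForm.

(** * Projections and isometries in Hilbert spaces *)

Section HilbertGeometry.
Variable R : realType.
Local Notation C := R[i].
Local Open Scope complex_scope.

Section OneSpace.
Variable H : hilbertSpace R.
Implicit Types x y z : H.

Fact inner_is_linear a x y z :
  inner H (a *: x + y) z = a * inner H x z + inner H y z.
Proof. by rewrite linearDl linearZl_LR. Qed.

Fact inner_conj x y : inner H y x = (inner H x y)^*%R.
Proof. by rewrite [LHS]hermC /= expr0 mul1r. Qed.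

Fact inner_ge0 x : 0 <= inner H x x.
Proof. by rewrite inner_norm exprn_ge0. Qed.

Definition hilbert_form : semi_inner H :=
  SemiInner inner_is_linear inner_conj inner_ge0.

Lemma hilbert_formE x y : hilbert_form x y = inner H x y.
Proof. by []. Qed.

Lemma snorm_hilbert x : snorm hilbert_form x = `|x|.
Proof. by rewrite /snorm /= inner_norm sqrCK. Qed.

Lemma inner_cauchy_schwarz x y : `|inner H x y| <= `|x| * `|y|.
Proof. by rewrite -!snorm_hilbert; exact: (sform_cauchy_schwarz hilbert_form). Qed.

Lemma innerBl x y z : inner H (x - y) z = inner H x z - inner H y z.
Proof. exact: (sformBl hilbert_form). Qed.

Lemma innerZl a x z : inner H (a *: x) z = a * inner H x z.
Proof. exact: (sformZl hilbert_form). Qed.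

Lemma inner_suml I (r : seq I) (F : I -> H) y :
  inner H (\sum_(i <- r) F i) y = \sum_(i <- r) inner H (F i) y.
Proof.
apply: (big_morph (fun x => inner H x y)) => [? ?|].
  by rewrite linearDl.
by rewrite linear0l.
Qed.

Lemma inner0_eq0 x : inner H x x = 0 -> x = 0.
Proof.
by move=> /eqP; rewrite inner_norm expf_eq0 /= normr_eq0 => /eqP.
Qed.

Lemma cvgn_innerl (u : nat -> H) x y :
  u @ \oo --> x -> (fun n => inner H (u n) y) @ \oo --> (inner H x y : C^o).
Proof.
move=> /cvgn_complexP ux; apply/cvgn_scalarP => e e0.
have y1 : 0 < `|y| + 1 by rewrite ltr_wpDl.
have [N hN] := ux _ (divr_gt0 e0 y1); exists N => n /hN un.
rewrite -innerBl (le_trans (inner_cauchy_schwarz _ _)) //.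
rewrite (le_trans (ler_wpM2l (normr_ge0 _) (_ : _ <= `|y| + 1))) ?lerDl //.
by rewrite -ler_pdivlMr.
Qed.

Lemma cvgn_innerr (u : nat -> H) x y :
  u @ \oo --> x -> (fun n => inner H y (u n)) @ \oo --> (inner H y x : C^o).
Proof.
move=> /(@cvgn_innerl _ _ y)/cvgn_conj; rewrite -inner_conj.
by under eq_fun do rewrite -inner_conj.
Qed.

(** A predicate, so that minimality arguments become inductions over the vectors
    of a Hilbert space. *)
Definition closed_subspace (P : H -> Prop) : Prop :=
  [/\ P 0, forall a x y, P x -> P y -> P (a *: x + y)
    & forall u l, (forall n, P (u n)) -> u @ \oo --> l -> P l].

Lemma parallelogram x y :
  `|x - y| ^+ 2 = 2 * `|x| ^+ 2 + 2 * `|y| ^+ 2 - `|x + y| ^+ 2.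
Proof.
rewrite -!inner_norm -!hilbert_formE !sform_rules.
by ring.
Qed.

Lemma real_normE x : `|x| = (complex.Re `|x|)%:C.
Proof. by have [r _ ->] := complex_ge0P (normr_ge0 x). Qed.

(** Otherwise subtracting [(inner x y / (|y|^2 + 1)) *: y] would shorten [x]. *)
Lemma orthogonal_of_minimal x y :
  (forall a : C, `|x| <= `|x - a *: y|) -> inner H x y = 0.
Proof.
move=> xy; set b := inner H x y; apply/eqP; apply: contraT => b0.
have n0 : 0 < `|b| ^+ 2 by rewrite exprn_gt0 // normr_gt0.
pose c := `|y| ^+ 2 + 1; have c0 : 0 < c by rewrite ltr_wpDl.
have cr : c^*%R = c by rewrite geC0_conj // ltW.
have := xy (b / c); rewrite -(@ler_pXn2r _ 2) ?nnegrE // -!inner_norm.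
rewrite -!hilbert_formE !sform_rules [hilbert_form y x]inner_conj -/b.
rewrite !hilbert_formE -/b rmorphM /= fmorphV /= cr [inner H y y]inner_norm.
rewrite -subr_ge0.
have -> : inner H x x + - (b^*%R / c * b) + (- (b / c * b^*%R) +
    - - (b / c * (b^*%R / c * `|y| ^+ 2))) - inner H x x =
    - (b * b^*%R * (`|y| ^+ 2 + 2) / c ^+ 2).
  by rewrite /c; field; rewrite -/c gt_eqF.
rewrite -normCK oppr_ge0.
suff h : 0 < `|b| ^+ 2 * (`|y| ^+ 2 + 2) / c ^+ 2 by rewrite (lt_geF h).
apply: divr_gt0; last exact: exprn_gt0.
by apply: mulr_gt0 => //; rewrite ltr_wpDl // exprn_ge0.
Qed.

(** A minimizing sequence of the distance to [P] is Cauchy by the parallelogram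
    law, since midpoints stay in [P]. *)
Lemma projection P f : closed_subspace P ->
  exists2 p, P p & forall q, P q -> inner H (f - p) q = 0.
Proof.
move=> cP; have [P0 PD Pl] := cP.
pose D : set R := [set d | exists2 q, P q & d = complex.Re `|f - q| ^+ 2].
have D0 : D !=set0 by exists (complex.Re `|f - 0| ^+ 2), 0.
have lbD : lbound D 0 by move=> _ [q _ ->]; exact: sqr_ge0.
pose d := inf D.
have dD q : P q -> (d%:C <= `|f - q| ^+ 2).
  move=> Pq; rewrite real_normE -rmorphXn lecR; apply: ge_inf; last by exists q.
  by exists 0.
have /choice[q hq] : forall n : nat, exists q, P q /\ `|f - q| ^+ 2 <= d%:C + n.+1%:R^-1.
  move=> n; have n0 : 0 < n.+1%:R^-1 :> R by rewrite invr_gt0.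
  have [_ [q Pq ->] qd] := inf_adherent n0 (conj D0 (ex_intro _ _ lbD)).
  exists q; split=> //; rewrite real_normE -rmorphXn.
  have -> : n.+1%:R^-1 = (n.+1%:R^-1)%:C :> C by rewrite fmorphV rmorph_nat.
  by rewrite -rmorphD lecR ltW.
have qd n m : `|q n - q m| ^+ 2 <= 2 * n.+1%:R^-1 + 2 * m.+1%:R^-1.
  have -> : q n - q m = (f - q m) - (f - q n) by rewrite [RHS]addrC opprB subrKA.
  rewrite parallelogram.
  have := dD (2^-1 *: q m + (2^-1 *: q n + 0)).
  have Pmid : P (2^-1 *: q m + (2^-1 *: q n + 0)).
    by apply: (PD); [case: (hq m)|apply: (PD); [case: (hq n)|]].
  move=> /(_ Pmid); rewrite addr0.
  have -> : f - (2^-1 *: q m + 2^-1 *: q n) = 2^-1 *: (f - q m + (f - q n)).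
    have fE : f = 2^-1 *: (f + f).
      by rewrite -mulr2n -[f *+ 2]scaler_nat scalerA mulVf ?pnatr_eq0 // scale1r.
    by rewrite [in RHS]addrACA scalerDr -fE -opprD scalerN scalerDr.
  rewrite normrZ exprMn normfV gtr0_norm // => mid.
  have {}mid : 4 * d%:C <= `|f - q m + (f - q n)| ^+ 2.
    by rewrite -ler_pdivlMl //; move: mid; rewrite exprVn -natrX.
  have [[_ hn] [_ hm]] := (hq n, hq m).
  rewrite -subr_ge0.
  have -> : 2 * n.+1%:R^-1 + 2 * m.+1%:R^-1 - (2 * `|f - q m| ^+ 2 +
      2 * `|f - q n| ^+ 2 - `|f - q m + (f - q n)| ^+ 2) =
      2 * (d%:C + m.+1%:R^-1 - `|f - q m| ^+ 2) +
      2 * (d%:C + n.+1%:R^-1 - `|f - q n| ^+ 2) +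
      (`|f - q m + (f - q n)| ^+ 2 - 4 * d%:C).
    by ring.
  apply: addr_ge0; last by rewrite subr_ge0.
  by apply: addr_ge0; apply: mulr_ge0 => //; rewrite subr_ge0.
have [p qp] : exists p : H, q @ \oo --> p.
  apply: is_cauchy_cvgn => e e0.
  have e2 : 0 < e ^+ 2 / 4 by rewrite divr_gt0 ?exprn_gt0.
  have [N hN] := complex_archimedean e2; exists N => i j iN jN.
  rewrite -(@ler_pXn2r _ 2) ?nnegrE ?(ltW e0) // (le_trans (qd _ _)) //.
  have -> : e ^+ 2 = 2 * (e ^+ 2 / 4) + 2 * (e ^+ 2 / 4) by field.
  by apply: lerD; rewrite ler_wpM2l // hN.
have Pp : P p by apply: (Pl q) => // n; case: (hq n).
exists p => // r Pr; apply: orthogonal_of_minimal => a.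
apply: complex_le_addgt0 => e e0.
have e2 : 0 < e / 2 by rewrite divr_gt0.
have [N1 hN1] := complex_archimedean (exprn_gt0 2 e2).
have /cvgn_complexP/(_ _ e2)[N2 hN2] := qp.
pose n := maxn N1 N2; have [_ hqn] := hq n.
have Ppar : P (p + a *: r) by rewrite addrC; exact: PD.
rewrite (le_trans (ler_distD (q n) _ _)) // [e]splitr addrA lerD //; last first.
  by rewrite distrC hN2 // leq_maxr.
rewrite -(@ler_pXn2r _ 2) ?nnegrE ?addr_ge0 ?(ltW e2) // (le_trans hqn) //.
rewrite -addrA -opprD sqrrD; apply: lerD; last by rewrite hN1 // leq_maxl.
by rewrite (le_trans (dD _ Ppar)) // lerDl mulrn_wge0 // mulr_ge0 // ltW.
Qed.

Lemma orthogonal_trivial_full P : closed_subspace P ->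
  (forall f, (forall q, P q -> inner H f q = 0) -> f = 0) -> forall f, P f.
Proof.
move=> cP P0 f; have [p Pp fp] := projection f cP.
by have /eqP := P0 _ fp; rewrite subr_eq0 => /eqP ->.
Qed.

(** Density of the span, as an induction principle. *)
Definition total_family (I : Type) (D : set I) (x : I -> H) : Prop :=
  forall P, closed_subspace P -> (forall i, D i -> P (x i)) -> forall f, P f.

Lemma separating_total I (D : set I) (x : I -> H) :
  (forall f, (forall i, D i -> inner H f (x i) = 0) -> f = 0) -> total_family D x.
Proof.
move=> sx P cP Px; apply: orthogonal_trivial_full => // f fP.
by apply: sx => i Di; apply: fP; exact: Px.
Qed.

End OneSpace.

Section IsometricExtension.
Variables (H K : hilbertSpace R).

Lemma isometry_norm (V : {linear H -> K}) :
  (forall f g, inner K (V f) (V g) = inner H f g) -> forall f, `|V f| = `|f|.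
Proof. by move=> Viso f; rewrite -!snorm_hilbert /snorm /= Viso. Qed.

Lemma isometry_cvg (V : {linear H -> K}) (u : nat -> H) f :
    (forall f, `|V f| = `|f|) ->
  u @ \oo --> f -> (fun n => V (u n)) @ \oo --> V f.
Proof.
move=> Viso /cvgn_complexP uf; apply/cvgn_complexP => eps /uf[M hM].
by exists M => n /hM; rewrite -(raddfB V) Viso.
Qed.

Lemma closed_subspace_range (V : {linear H -> K}) :
  (forall f, `|V f| = `|f|) -> closed_subspace (fun g => exists f, V f = g).
Proof.
move=> Viso; split; first by exists 0; rewrite raddf0.
  by move=> a _ _ [f <-] [g <-]; exists (a *: f + g); rewrite linearP.
move=> u l /choice[f Vf] ul.
have Vfu : u = V \o f by apply/funext => n; rewrite /= Vf.
have [|g fg] := @is_cauchy_cvgn _ _ f.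
  move=> e /(cvgn_is_cauchy ul)[N hN]; exists N => i j iN jN.
  by rewrite -Viso raddfB /= !Vf hN.
exists g; apply: cvgn_unique ul.
apply/cvgn_complexP => e; move/cvgn_complexP : fg => /[apply] -[N hN].
by exists N => n /hN; rewrite -Vf -(raddfB V) Viso.
Qed.

(** The graph of the extension is the smallest closed linear relation containing
    the given pairs. Inner products agree along this relation, which makes it the
    graph of an isometry; completeness of [K] makes its domain closed. *)
Lemma isometric_extension (I : Type) (D : set I) (x : I -> H) (y : I -> K) :
    total_family D x ->
    (forall i j, D i -> D j -> inner K (y i) (y j) = inner H (x i) (x j)) ->
  exists V : {linear H -> K},
    [/\ forall f g, inner K (V f) (V g) = inner H f g
       & forall i, D i -> V (x i) = y i].
Proof.
move=> tx xy.
pose closed_relation (G : H -> K -> Prop) := [/\ G 0 0,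
  forall a f g f' g', G f g -> G f' g' -> G (a *: f + f') (a *: g + g')
  & forall u v f g, (forall n, G (u n) (v n)) -> u @ \oo --> f -> v @ \oo --> g ->
      G f g].
pose graph f g := forall G, closed_relation G -> (forall i, D i -> G (x i) (y i)) ->
  G f g.
have cgraph : closed_relation graph.
  split=> [G [] //|a f g f' g' fg f'g' G cG Gxy|u v f g uv uf vg G cG Gxy].
    by have [_ GD _] := cG; apply: GD; [exact: fg|exact: f'g'].
  by have [_ _ Gl] := cG; apply: (Gl u v) => // n; exact: uv.
have graphx i : D i -> graph (x i) (y i) by move=> Di G _; exact.
have graph_inner f g f' g' : graph f g -> graph f' g' -> inner K g g' = inner H f f'.
  have step (f1 : H) (g1 : K) :
      closed_relation (fun f g => inner K g g1 = inner H f f1).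
    split=> [|a h k h' k' hk h'k'|u v h k uv uh vk].
    - by rewrite -!hilbert_formE !sform0l.
    - by rewrite !inner_is_linear hk h'k'.
    - have c1 := @cvgn_innerl _ _ _ g1 vk; have c2 := @cvgn_innerl _ _ _ f1 uh.
      move: c1; under eq_fun do rewrite uv.
      by move=> c1; exact: (@cvgn_unique _ C^o _ _ _ c1 c2).
  move=> fg fg'.
  apply: (fg' (fun f' g' => inner K g g' = inner H f f')); last first.
    move=> i Di.
    apply: (fg (fun f g => inner K g (y i) = inner H f (x i))); first exact: step.
    by move=> j Dj; exact: xy.
  split=> [|a h k h' k' hk h'k'|u v h k uv uh vk].
  - by rewrite -!hilbert_formE !sform0r.
  - by rewrite -!hilbert_formE !sform_rules !hilbert_formE hk h'k'.
  - have c1 := @cvgn_innerr _ _ _ g vk; have c2 := @cvgn_innerr _ _ _ f uh.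
    move: c1; under eq_fun do rewrite uv.
    by move=> c1; exact: (@cvgn_unique _ C^o _ _ _ c1 c2).
have graph_norm f g : graph f g -> `|g| = `|f|.
  move=> fg; rewrite -!snorm_hilbert /snorm /=.
  by rewrite (graph_inner _ _ _ _ fg fg).
have [gr0 grD grl] := cgraph.
have graph_fun f g g' : graph f g -> graph f g' -> g = g'.
  move=> fg fg'; apply/eqP; rewrite -subr_eq0 -normr_eq0.
  have := grD (- 1) _ _ _ _ fg' fg; rewrite !scaleN1r addNr => /graph_norm.
  by rewrite addrC normr0 => ->.
have /choice[V hV] : forall f, exists g, graph f g.
  apply: tx => [|i Di]; last by exists (y i); exact: graphx.
  split; first by exists 0.
    by move=> a f f' [g fg] [g' f'g']; exists (a *: g + g'); exact: grD.
  move=> u f /choice[v uv] uf.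
  have [|g vg] := @is_cauchy_cvgn _ _ v.
    move=> e /(cvgn_is_cauchy uf)[N hN]; exists N => i j iN jN.
    have := grD (- 1) _ _ _ _ (uv j) (uv i).
    rewrite !scaleN1r ![- _ + _]addrC => /graph_norm ->; exact: hN.
  by exists g; exact: (grl u v).
have Vlin : linear V.
  by move=> a f g; apply: graph_fun (hV _) _; exact: grD.
pose VL := GRing.isLinear.Build C H K _ V Vlin.
pose Vl : {linear H -> K} := HB.pack V VL.
exists Vl; split=> [f g|i Di]; first exact: graph_inner.
by apply: graph_fun (hV _) _; exact: graphx.
Qed.

End IsometricExtension.

End HilbertGeometry.

(** * Power series *)

Section PowerSeries.
Variable R : realType.
Local Notation C := R[i].
Local Open Scope complex_scope.

Lemma geometric_sum_le (K : numFieldType) (x : K) n :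
  0 <= x -> x <= 2^-1 -> \sum_(i < n) x ^+ i <= 2.
Proof.
move=> x0 x1; elim: n => [|n IHn]; first by rewrite big_ord0.
rewrite big_ord_recl expr0.
under eq_bigr => i _ do rewrite lift0 exprS.
rewrite -mulr_sumr [leRHS](_ : 2 = 1 + 2^-1 * 2); last by rewrite mulVf.
by rewrite lerD2l ler_pM // sumr_ge0 // => i _; rewrite exprn_ge0.
Qed.

Lemma partial_sums_bounded (u : nat -> C) (l : C) :
    (fun n => \sum_(k < n) u k) @ \oo --> (l : C^o) ->
  exists M : C, 0 <= M /\ forall k, `|u k| <= M.
Proof.
move=> /(@cvgn_is_cauchy _ C^o) /(_ 1 ltr01)[N hN].
have S0 : 0 <= \sum_(i < N) `|u i| by apply: sumr_ge0.
exists (\sum_(i < N) `|u i| + 1); split=> [|k]; first by rewrite addr_ge0.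
have [kN|Nk] := ltnP k N.
  rewrite (bigD1 (Ordinal kN)) //= -addrA lerDl addr_ge0 //.
  exact: sumr_ge0.
apply: (@le_trans _ _ 1); last by rewrite lerDr.
have := hN k.+1 k (leqW Nk) Nk; rewrite big_ord_recr /= addrAC subrr add0r.
exact.
Qed.

(** If [c_m] is the first coefficient that may be nonzero, then, for small [t > 0],
    [|c_m| t^m] is at most the sum of the later terms, which is [O(t^(m + 1))]
    because convergence at [1/2] gives [|c_k| <= M 2^k]. *)
Lemma power_series_unique (c : nat -> C) :
    (forall w : C, `|w| < 1 ->
      (fun n => \sum_(k < n) c k * w ^+ k) @ \oo --> (0 : C^o)) ->
  forall k, c k = 0.
Proof.
move=> c0; have half1 : `|2^-1 : C| < 1.
  by rewrite normfV normr_nat invf_lt1 // ltr1n.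
have [M [M0 hM]] := @partial_sums_bounded (fun k => c k * 2^-1 ^+ k) _ (c0 _ half1).
have {}hM k : `|c k| <= M * 2 ^+ k.
  have := hM k; rewrite normrM normrX normfV normr_nat exprVn.
  by rewrite ler_pdivrMr // exprn_gt0.
elim/ltn_ind => m IH; apply/eqP; rewrite -normr_le0.
apply: complex_le_addgt0 => e e0; rewrite add0r.
pose L := M * 2 ^+ m.+1 * 2 + 1.
have L0 : 0 < L by rewrite ltr_wpDl // !mulr_ge0 ?exprn_ge0.
have [p hp] := complex_archimedean (divr_gt0 e0 (ltr0Sn _ 1)).
have [q hq] := complex_archimedean (divr_gt0 (divr_gt0 e0 (ltr0Sn _ 1)) L0).
pose t : C := (maxn 3 q).+1%:R^-1.
have t0 : 0 < t by rewrite invr_gt0.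
have tq : t <= e / 2 / L by apply: hq; exact: leq_maxr.
have t4 : t <= 4^-1.
  by rewrite lef_pV2 ?posrE // ler_nat ltnS leq_maxl.
have t1 : `|t| < 1.
  rewrite gtr0_norm // (le_lt_trans t4) // invf_lt1 // ltr1n //.
have tm0 : 0 < t ^+ m by rewrite exprn_gt0.
have /cvgn_scalarP/(_ _ (mulr_gt0 (divr_gt0 e0 (ltr0Sn _ 1)) tm0))[N hN] := c0 t t1.
pose n := (m.+1 + N)%N; have := hN n (leq_addl _ _).
rewrite sub0r normrN /n big_split_ord /= big_ord_recr /= big1 => [|i _]; last first.
  by rewrite IH ?mul0r.
rewrite add0r; set rest := \sum_(i < N) _ => hS.
have hrest : `|rest| <= e / 2 * t ^+ m.
  have t20 : 0 <= 2 * t by rewrite mulr_ge0 ?ltW.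
  apply: (@le_trans _ _ (\sum_(i < N) M * 2 ^+ m.+1 * t ^+ m.+1 * (2 * t) ^+ i)).
    apply: le_trans (ler_norm_sum _ _ _) _; apply: ler_sum => i _.
    rewrite normrM normrX (gtr0_norm t0).
    apply: le_trans (ler_wpM2r _ (hM _)) _; first by rewrite exprn_ge0 ?ltW.
    by rewrite exprMn !exprD le_eqVlt; apply/orP; left; apply/eqP; ring.
  rewrite -mulr_sumr.
  have c1 : 0 <= M * 2 ^+ m.+1 * t ^+ m.+1.
    by rewrite !mulr_ge0 ?exprn_ge0 ?(ltW t0).
  apply: le_trans (ler_wpM2l c1 (geometric_sum_le _ t20 _)) _.
    rewrite [leRHS](_ : _ = 2 * 4^-1); last by field.
    by rewrite ler_pM2l.
  have -> : M * 2 ^+ m.+1 * t ^+ m.+1 * 2 = (M * 2 ^+ m.+1 * 2 * t) * t ^+ m.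
    by rewrite [t ^+ m.+1]exprS; ring.
  rewrite ler_pM2r //; apply: (@le_trans _ _ (L * t)).
    by rewrite ler_pM2r // /L lerDl.
  by rewrite -ler_pdivlMl // mulrC.
rewrite -(@ler_pM2r _ (t ^+ m)) // -{1}(gtr0_norm tm0) -normrM.
rewrite -[X in `|X|](addrK rest) (le_trans (ler_normB _ _)) //.
by rewrite [e in leRHS]splitr mulrDl lerD.
Qed.

(** The ratio of consecutive terms is [r (l + k) / (m + k)], which is eventually
    at most [1]. *)
Lemma rising_ratio_growth (l m r : R) : 0 < l -> 0 < m -> 0 < r -> r < 1 ->
  exists M : R, forall k, rising l k / rising m k * r ^+ k <= M.
Proof.
move=> l0 m0 r0 r1; pose u k := rising l k / rising m k * r ^+ k.
have u0 k : 0 <= u k.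
  by rewrite mulr_ge0 ?divr_ge0 ?exprn_ge0 // ltW // rising_gt0.
have r1' : 0 < 1 - r by rewrite subr_gt0.
pose N := (Num.truncn `|r * l / (1 - r)|).+1.
have ratio k : (N <= k)%N -> u k.+1 <= u k.
  move=> Nk; have mk : 0 < m + k%:R by rewrite ltr_pwDl.
  have -> : u k.+1 = u k * (r * (l + k%:R) / (m + k%:R)).
    by rewrite /u !risingS exprS; field; rewrite !gt_eqF ?rising_gt0.
  rewrite ler_piMr // ler_pdivrMr // mul1r mulrDr -lerBrDr -addrA.
  rewrite -[X in _ + (X - _)]mul1r -mulrBl.
  apply: (@le_trans _ _ ((1 - r) * k%:R)); last by rewrite lerDr ltW.
  rewrite -ler_pdivrMl // mulrC (le_trans (ler_norm _)) //.
  by rewrite (le_trans (ltW (truncnS_gt _))) // ler_nat.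
exists (\sum_(i < N.+1) u i) => k; rewrite -/(u k).
have part j : (j <= N)%N -> u j <= \sum_(i < N.+1) u i.
  move=> jN; rewrite (bigD1 (Ordinal (jN : (j < N.+1)%N))) //= lerDl.
  by apply: sumr_ge0 => i _; exact: u0.
have [kN|/ltnW Nk] := leqP k N; first exact: part.
rewrite -(subnKC Nk); elim: (k - N)%N => [|j IHj]; first by rewrite addn0 part.
by rewrite addnS (le_trans (ratio _ _)) // leq_addr.
Qed.

(** Comparison with a geometric series of ratio [s] such that [r <= s^2], where
    growth is controlled by [s]. *)
Lemma rising_ratio_summable (l m r : R) : 0 < l -> 0 < m -> 0 <= r -> r < 1 ->
  cvgn (fun n => \sum_(k < n) rising l k / rising m k * r ^+ k).
Proof.
move=> l0 m0 r0 r1.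
pose s := Num.max (Num.sqrt r) 2^-1.
have s0 : 0 < s by rewrite lt_max orbC invr_gt0 ltr0n.
have s1 : s < 1 by rewrite gt_max -sqrtr1 ltr_sqrt // r1 sqrtr1 invf_lt1 // ltr1n.
have rs : r <= s * s.
  have sr : Num.sqrt r <= s by rewrite le_max lexx.
  by rewrite -{1}(sqr_sqrtr r0) expr2 ler_pM ?sqrtr_ge0.
have [M hM] := rising_ratio_growth l0 m0 s0 s1.
have c0 k : 0 <= rising l k / rising m k by rewrite divr_ge0 // ltW // rising_gt0.
have M0 : 0 <= M by rewrite (le_trans _ (hM 0)) // mulr_ge0 ?exprn_ge0 // ltW.
apply: nondecreasing_is_cvgn.
  apply/nondecreasing_seqP => n; rewrite big_ord_recr /= lerDl.
  by rewrite mulr_ge0 ?exprn_ge0.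
exists (M / (1 - s)) => _ [n _ <-].
apply: (@le_trans _ _ (\sum_(k < n) M * s ^+ k)).
  apply: ler_sum => k _.
  apply: (@le_trans _ _ (rising l k / rising m k * s ^+ k * s ^+ k)).
    by rewrite -[leRHS]mulrA -exprMn ler_wpM2l // lerXn2r ?nnegrE // mulr_ge0 // ltW.
  by rewrite ler_wpM2r // exprn_ge0 // ltW.
rewrite -mulr_sumr ler_wpM2l // -[leRHS]mul1r ler_pdivlMr ?subr_gt0 //.
rewrite mulrC -opprB mulNr -subrX1 opprB lerBlDr lerDl.
by rewrite exprn_ge0 // ltW.
Qed.

Lemma is_cauchy_dominated (u : nat -> C) (v : nat -> R) :
    (forall k, `|u k| <= (v k)%:C) -> cvgn (fun n => \sum_(k < n) v k) ->
  is_cauchy (@Num.norm _ C) (fun n => \sum_(k < n) u k).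
Proof.
move=> uv cv e /complex_gt0P[r r0 ->].
have /cvg_ex[l /cvgrPdist_le/(_ _ (divr_gt0 r0 (ltr0Sn _ 1)))[N _ hN]] := cv.
have diff i j : (i <= j)%N -> `|\sum_(k < j) u k - \sum_(k < i) u k| <=
    (\sum_(k < j) v k - \sum_(k < i) v k)%:C.
  move=> /subnKC <-; rewrite !big_split_ord /= ![_ + _ - _]addrAC !subrr !add0r.
  apply: le_trans (ler_norm_sum _ _ _) _; rewrite rmorph_sum.
  by apply: ler_sum => k _; exact: uv.
have close i j : (N <= i)%N -> (N <= j)%N ->
    \sum_(k < j) v k - \sum_(k < i) v k <= r.
  move=> /hN hi /hN hj; rewrite (le_trans (ler_norm _)) //.
  rewrite (le_trans (ler_distD l _ _)) // [r]splitr lerD // distrC.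
  exact: hj.
exists N => i j Ni Nj; have [ij|/ltnW ji] := leqP i j.
  by rewrite distrC (le_trans (diff _ _ ij)) // lecR close.
by rewrite (le_trans (diff _ _ ji)) // lecR close.
Qed.

Lemma kernel_lm_cvg (l m : R) (z w : C) : 0 < l -> 0 < m ->
    `|z| < 1 -> `|w| < 1 ->
  (fun n => \sum_(k < n) (rising l k / rising m k)%:C * (z * w^*%R) ^+ k) @ \oo -->
    (kernel_lm l m z w : C^o).
Proof.
move=> l0 m0 z1 w1; pose x := z * w^*%R.
have [r r0 xr] := complex_ge0P (normr_ge0 x).
have r1 : r < 1.
  by rewrite -ltcR -xr normrM norm_conjC mulr_ilt1.
pose u k : C := (rising l k / rising m k)%:C * x ^+ k.
pose v k : R := rising l k / rising m k * r ^+ k.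
have [|t ut] := @complex_is_cauchy_cvgn _ _ (@is_cauchy_dominated u v _
    (rising_ratio_summable l0 m0 r0 r1)).
  move=> k.
  rewrite /u normrM normrX xr normc_real ger0_norm; last first.
    by rewrite divr_ge0 // ltW // rising_gt0.
  by rewrite /v [leRHS]rmorphM [X in _ <= _ * X]rmorphXn.
suff -> : kernel_lm l m z w = t by exact: ut.
rewrite /kernel_lm; apply: (cvg_lim (@norm_hausdorff _ C^o)).
rewrite (_ : series _ = (fun n => \sum_(k < n) u k)) //.
apply/funext => n; rewrite /series /= big_mkord; apply: eq_bigr => k _.
by rewrite !pochhammerE.
Qed.

End PowerSeries.

(** * Subnormality of multiplication by the coordinate *)

Section NormalModel.
Variable R : realType.
Local Notation C := R[i].
Local Open Scope complex_scope.

(** The completion of the polynomials in [z] and its conjugate, with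
    multiplication by [z] as the normal operator and multiplication by its
    conjugate as the adjoint; the vectors [e m] are the powers of [z]. *)
Lemma completely_monotone_normal_model (g : nat -> R) :
    completely_monotone g ->
  exists (K : hilbertSpace R) (N : {linear K -> K}) (e : nat -> K),
    [/\ forall m n, inner K (e m) (e n) = if m == n then (g m)%:C else 0,
        forall m, N (e m) = e m.+1,
        forall f, `|N f| <= `|f| & normal_operator N].
Proof.
move=> cmg; pose B := moment_inner cmg.
pose adj := moment_form_adjoint cmg.
pose contr := moment_form_coord cmg.
have contrb p : B (mulcoord (coordzb R) p) (mulcoord (coordzb R) p) <= B p p.
  by rewrite /= moment_form_coordb; exact: contr.
pose N : {linear completion B -> completion B} := extension adj contr.
pose S : {linear completion B -> completion B} :=
  extension (sform_adjointC adj) contrb.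
exists (completion_hilbert B), N, (fun m => embed B (coordz R ^+ m)); split.
- move=> m n; rewrite -moment_form_powers; exact: (completion_form_embed2 B).
- move=> m; apply: etrans (extension_embed adj contr _) _.
  by rewrite /= /mulcoord -exprS.
- exact: (norm_extension adj contr).
- exists S; split.
  + exists 1 => f; rewrite mul1r.
    exact: (norm_extension (sform_adjointC adj) contrb).
  + exact: (extension_adjoint adj contr contrb).
  + move=> f; apply: (@extension_commute _ _ _ _ _ adj contr contrb f) => p.
    by rewrite /= /mulcoord mulrCA.
Qed.

End NormalModel.

Section DiagonalKernel.
Variable R : realType.
Local Notation C := R[i].
Local Open Scope complex_scope.
Variables (a : nat -> R) (ker : C -> C -> C).
Hypothesis a_gt0 : forall k, 0 < a k.
Hypothesis cma : completely_monotone (fun k => (a k)^-1).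
Hypothesis ker_cvg : forall z w : C, unit_disc z -> unit_disc w ->
  (fun n => \sum_(k < n) (a k)%:C * (z * w^*%R) ^+ k) @ \oo --> (ker z w : C^o).

Section Model.
Variables (K : hilbertSpace R) (N : {linear K -> K}) (e : nat -> K).
Hypothesis e_inner :
  forall m n, inner K (e m) (e n) = if m == n then ((a m)^-1)%:C else 0.
Hypothesis Ne : forall m, N (e m) = e m.+1.
Hypothesis N_contr : forall f, `|N f| <= `|f|.

(** Partial sums of the expansion of the kernel function at [w], computed in the
    model, where [e k] stands for [z^k]. *)
Definition kernel_partial (w : C) (n : nat) : K :=
  \sum_(k < n) ((a k)%:C * (w^*%R) ^+ k) *: e k.

Lemma inner_power_partial m w n : (m < n)%N ->
  inner K (e m) (kernel_partial w n) = w ^+ m.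
Proof.
move=> mn; rewrite inner_conj inner_suml (bigD1 (Ordinal mn)) //= big1.
  rewrite addr0 innerZl e_inner eqxx mulrAC -rmorphM /= mulfV ?gt_eqF //.
  by rewrite rmorph1 mul1r rmorphXn /= conjCK.
move=> i im; rewrite innerZl e_inner ifN ?mulr0 //.
Qed.

Lemma inner_partial_partial v w n p : (n <= p)%N ->
  inner K (kernel_partial v n) (kernel_partial w p) =
  \sum_(k < n) (a k)%:C * (w * v^*%R) ^+ k.
Proof.
move=> np; rewrite inner_suml; apply: eq_bigr => k _.
rewrite innerZl inner_power_partial ?(leq_trans (ltn_ord k)) //.
by rewrite exprMn; ring.
Qed.

Lemma kernel_partial_cauchy w : unit_disc w ->
  is_cauchy (@Num.norm _ K) (kernel_partial w).
Proof.
move=> w1 eps eps0.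
have [M hM] := @cvgn_is_cauchy _ C^o _ _ (ker_cvg w1 w1) _ (exprn_gt0 2 eps0).
have dist n p : (n <= p)%N -> (M <= n)%N -> (M <= p)%N ->
    `|kernel_partial w p - kernel_partial w n| <= eps.
  move=> np Mn Mp; rewrite -(@ler_pXn2r _ 2) ?nnegrE ?(ltW eps0) //.
  rewrite -inner_norm -(@hilbert_formE _ K) sformBl !sformBr !hilbert_formE.
  rewrite [inner K (kernel_partial w p) (kernel_partial w n)]inner_conj.
  rewrite !inner_partial_partial //.
  rewrite [X in _ - X - _](_ : _ = \sum_(k < n) (a k)%:C * (w * w^*%R) ^+ k).
    rewrite subrr subr0 (le_trans (real_ler_norm _)) ?hM //.
    by rewrite rpredB // ger0_real // sumr_ge0 // => k _;
      rewrite mulr_ge0 ?ler0c ?(ltW (a_gt0 k)) // exprn_ge0 // mul_conjC_ge0.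
  rewrite rmorph_sum; apply: eq_bigr => k _.
  by rewrite rmorphM rmorphXn /= rmorphM /= conjCK conj_real_complex [w^*%R * w]mulrC.
exists M => i j Mi Mj; have [ij|/ltnW ji] := leqP i j; last exact: dist.
by rewrite distrC dist.
Qed.

Variable H : rkhs ker.

Lemma rkhs_eval0 w : unit_disc w -> rkhs_eval (0 : H) w = 0.
Proof.
move=> /(rkhs_reproducing H)[kw [_ kwE]].
by rewrite -kwE -hilbert_formE sform0l.
Qed.

(** A vector that is orthogonal to all kernel functions is the zero function. *)
Lemma kernel_functions_total (x : C -> H) :
    (forall w, unit_disc w -> forall f, inner H f (x w) = rkhs_eval f w) ->
  total_family (@unit_disc R) x.
Proof.
move=> xE; apply: separating_total => f f0; apply: rkhs_eval_inj => w w1.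
by rewrite rkhs_eval0 // -xE // f0.
Qed.

Lemma inner_power_kernel w y : kernel_partial w @ \oo --> y ->
  forall m, inner K (e m) y = w ^+ m.
Proof.
move=> wy m; apply: (@cvgn_unique _ C^o _ _ _ (cvgn_innerr (y := e m) wy)).
apply/cvgn_scalarP => eps eps0; exists m.+1 => n mn.
by rewrite inner_power_partial // subrr normr0 ltW.
Qed.

Lemma inner_partial_kernel v w y n : kernel_partial w @ \oo --> y ->
  inner K (kernel_partial v n) y = \sum_(k < n) (a k)%:C * (w * v^*%R) ^+ k.
Proof.
move=> wy; rewrite inner_suml; apply: eq_bigr => k _.
by rewrite innerZl (inner_power_kernel wy) exprMn; ring.
Qed.

Lemma N_kernel_partial v n :
  N (kernel_partial v n) = \sum_(k < n) ((a k)%:C * (v^*%R) ^+ k) *: e k.+1.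
Proof. by rewrite linear_sum; apply: eq_bigr => k _; rewrite linearZ_LR /= Ne. Qed.

Lemma cvgn_contraction (u : nat -> K) f :
  u @ \oo --> f -> (fun n => N (u n)) @ \oo --> N f.
Proof.
move=> /cvgn_complexP uf; apply/cvgn_complexP => eps /uf[M hM].
by exists M => n /hM; apply: le_trans; rewrite -(raddfB N) N_contr.
Qed.

(** Kernel functions and their expansions in the model have the same inner
    products, namely the values of the kernel. *)
Lemma kernel_embedding : exists (V : {linear H -> K}) (y : C -> K) (x : C -> H),
  [/\ forall f g, inner K (V f) (V g) = inner H f g,
      forall w, unit_disc w -> kernel_partial w @ \oo --> y w,
      forall w, unit_disc w -> forall f, inner H f (x w) = rkhs_eval f w
    & forall w, unit_disc w -> V (x w) = y w].
Proof.
have /choice[y hy] : forall w : C, exists y : K, unit_disc w -> kernel_partial w @ \oo --> y.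
  move=> w; have [w1|w1] := pselect (unit_disc w); last by exists 0.
  by have [y wy] := is_cauchy_cvgn (kernel_partial_cauchy w1); exists y.
have /choice[x hx] : forall w : C, exists x : H, unit_disc w ->
    (forall z, unit_disc z -> rkhs_eval x z = ker z w) /\
    (forall f : H, inner H f x = rkhs_eval f w).
  move=> w; have [w1|w1] := pselect (unit_disc w); last by exists 0.
  by have [x hx] := rkhs_reproducing H w1; exists x.
have [|v w v1 w1|V [Viso Vx]] := @isometric_extension _ H K _ (@unit_disc R) x y.
- by apply: kernel_functions_total => w /hx[].
- have [_ ->//] := hx w w1; have [-> // _] := hx v v1.
  have c1 := cvgn_innerl (y := y w) (hy v v1).
  apply: (@cvgn_unique _ C^o _ _ _ c1).
  under eq_fun do rewrite (inner_partial_kernel _ _ (hy w w1)).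
  exact: ker_cvg.
- by exists V, y, x; split=> // w /hx[].
Qed.

(** The component [q] of [e m] orthogonal to the range is orthogonal to all
    expansions of kernel functions; expanding [inner q (y w)] as a power series
    in [w] that vanishes on the disc, [q] is orthogonal to every [e k], hence
    to itself. *)
Lemma power_in_range (V : {linear H -> K}) (y : C -> K) (x : C -> H) m :
    (forall f g, inner K (V f) (V g) = inner H f g) ->
    (forall w, unit_disc w -> kernel_partial w @ \oo --> y w) ->
    (forall w, unit_disc w -> V (x w) = y w) ->
    closed_subspace (fun h => exists f, V f = h) ->
  exists f, V f = e m.
Proof.
move=> Viso hy Vx cV; have [p Pp ep] := projection (e m) cV.
set q := e m - p in ep.
have qe k : inner K q (e k) = 0.
  have : (a k)%:C * inner K q (e k) = 0.
    apply: (@power_series_unique R (fun j => (a j)%:C * inner K q (e j))) => w w1.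
    have := cvgn_innerr (y := q) (hy w w1).
    rewrite ep; last by exists (x w); exact: Vx.
    under eq_fun => n.
      rewrite inner_conj inner_suml rmorph_sum /=.
      under eq_bigr => j _.
        rewrite innerZl rmorphM rmorphM /= -inner_conj conj_real_complex.
        rewrite rmorphXn /= conjCK mulrAC.
        over.
      over.
    exact.
  move=> /eqP; rewrite mulf_eq0 => /orP[|/eqP //].
  by rewrite eq_complex /= gt_eqF.
suff q0 : q = 0 by have [f Vf] := Pp; exists f; apply/eqP; rewrite Vf eq_sym -subr_eq0 -/q q0.
apply: inner0_eq0; rewrite {2}/q -hilbert_formE sformBr !hilbert_formE.
by rewrite qe ep // subr0.
Qed.

(** The range of [V] is invariant under [N]: this property is closed and holds
    on kernel functions, whose images have expansions in the vectors [e k.+1].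
    The operator obtained on [H] multiplies by the coordinate, because the same
    kind of argument gives [inner (N f) (y z) = z * inner f (y z)] on the range. *)
Lemma multiplication_restricts : exists (V : {linear H -> K}) (T : {linear H -> H}),
  [/\ forall f g, inner K (V f) (V g) = inner H f g,
      forall f, N (V f) = V (T f) & is_mulz T].
Proof.
have [V [y [x [Viso hy xE Vx]]]] := kernel_embedding.
have Vnorm := isometry_norm Viso.
have cV := closed_subspace_range Vnorm; have [P0 PD Pl] := cV.
have tx := kernel_functions_total xE.
have Ppower m : exists f, V f = e m by exact: power_in_range Viso hy Vx cV.
have Psum n (c : nat -> C) : exists f, V f = \sum_(k < n) c k *: e k.+1.
  elim: n => [|n IHn]; first by rewrite big_ord0.
  by rewrite big_ord_recr /= addrC; exact: PD.
have invariant : forall f, exists h, V h = N (V f).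
  apply: tx => [|w w1].
    split; first by rewrite !raddf0.
      by move=> c f g Pf Pg; rewrite !linearP; exact: PD.
    move=> u f Pu uf; apply: (Pl (fun n => N (V (u n)))) => //.
    by apply: cvgn_contraction; exact: isometry_cvg.
  rewrite Vx //; apply: (Pl (fun n => N (kernel_partial w n))).
    move=> n; rewrite N_kernel_partial.
    exact: (Psum n (fun k => (a k)%:C * (w^*%R) ^+ k)).
  by apply: cvgn_contraction; exact: hy.
have /choice[T hT] := invariant.
have Vinj f g : V f = V g -> f = g.
  move=> Vfg; apply/eqP; rewrite -subr_eq0 -normr_eq0 -Vnorm raddfB /= Vfg subrr.
  by rewrite normr0.
have Tlin : linear T.
  by move=> c f g; apply: Vinj; rewrite linearP !hT !linearP.
pose Tm := GRing.isLinear.Build C H H _ T Tlin.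
pose Tl : {linear H -> H} := HB.pack T Tm.
exists V, Tl; split=> // f z z1.
rewrite -!xE //= -Viso hT -(Viso f) Vx //.
move: f; apply: tx => [|v v1].
  split.
  - by rewrite !raddf0 -hilbert_formE sform0l mulr0.
  - move=> c f g hf hg; rewrite !linearP !inner_is_linear hf hg; ring.
  - move=> u f hu uf; have Vuf := isometry_cvg Vnorm uf.
    have c1 := cvgn_innerl (y := y z) (cvgn_contraction Vuf).
    have c2 := @cvgn_scalarM _ z _ _ (cvgn_innerl (y := y z) Vuf).
    move: c1; under eq_fun do rewrite hu.
    by move=> c1; exact: (@cvgn_unique _ C^o _ _ _ c1 c2).
rewrite Vx //; have yv := hy v v1; have yz := hy z z1.
have c1 := cvgn_innerl (y := y z) (cvgn_contraction yv).
have c2 := @cvgn_scalarM _ z _ _ (cvgn_innerl (y := y z) yv).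
suff E n : inner K (N (kernel_partial v n)) (y z) =
    z * inner K (kernel_partial v n) (y z).
  move: c1; under eq_fun do rewrite E.
  by move=> c1; exact: (@cvgn_unique _ C^o _ _ _ c1 c2).
rewrite N_kernel_partial (inner_partial_kernel v n yz) inner_suml mulr_sumr.
apply: eq_bigr => k _; rewrite innerZl (inner_power_kernel yz) exprMn exprS.
ring.
Qed.

End Model.

(** Multiplication by the coordinate is a weighted shift with
    [|z^k|^2 = 1 / a k]; complete monotonicity of these squared norms provides
    the normal model that extends it. *)
Theorem diagonal_kernel_subnormal (H : rkhs ker) : exists Mz : {linear H -> H},
  [/\ is_mulz Mz, contractive Mz & subnormal Mz].
Proof.
have [K [N [e [e_inner Ne Ncontr Nnormal]]]] := completely_monotone_normal_model cma.
have [V [T [Viso NV TE]]] := multiplication_restricts e_inner Ne Ncontr H.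
have Vnorm := isometry_norm Viso.
have Tcontr f : `|T f| <= `|f| by rewrite -(Vnorm (T f)) -(Vnorm f) -NV.
have bT : bounded_operator T by exists 1 => f; rewrite mul1r.
exists T; split=> //; last first.
  by split=> //; exists K, V, N; split=> //; exists 1 => f; rewrite mul1r.
split=> //; apply: ge_sup; first by exists (complex.Re `|T 0|), 0; rewrite //= normr0 ler01.
move=> _ [f /= f1 <-]; have := le_trans (Tcontr f) f1.
by rewrite lecE => /andP[].
Qed.

End DiagonalKernel.

Theorem proposition2p12 (R : realType) (lambda lambda' mu : R)
    (mu_gt0 : 0 < mu) (le_mu : mu <= lambda') (le_lambda : lambda' <= lambda)
    (le_lambda1 : lambda <= lambda' + 1)
    (H : rkhs (fun z w : R[i] =>
                 kernel_lm lambda mu z w + kernel_lm lambda' mu z w)) :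
  exists Mz : {linear H -> H},
    [/\ is_mulz Mz, contractive Mz & subnormal Mz].
Proof.
have lambda'_gt0 := lt_le_trans mu_gt0 le_mu.
have lambda_gt0 := lt_le_trans lambda'_gt0 le_lambda.
pose a k := rising lambda k / rising mu k + rising lambda' k / rising mu k.
apply: (@diagonal_kernel_subnormal R a).
- by move=> k; rewrite addr_gt0 ?divr_gt0 ?rising_gt0.
- exact: completely_monotone_inv_rising_sum.
- move=> z w z1 w1.
  have := cvgn_scalarD (kernel_lm_cvg lambda_gt0 mu_gt0 z1 w1)
                       (kernel_lm_cvg lambda'_gt0 mu_gt0 z1 w1).
  under eq_fun do rewrite -big_split /=.
  under eq_fun => n do under eq_bigr => k _ do rewrite -mulrDl -rmorphD.
  exact.
Qed.
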